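(* $\mathbb{A}_+(1)=\mathbb{A}_+^{\mathcal B}(1)=\mathbb{A}_+^{\mathcal S}(1)$.
   Context: Fourier transform on $\mathbb{R}^d$: $\widehat f(\xi)=\int_{\mathbb{R}^d} f(x)e^{-2\pi i\langle x,\xi\rangle}\,dx$. A function $f:\mathbb{R}^d\to\mathbb{R}$ is eventually nonnegative if $f(x)\ge 0$ for all sufficiently large $|x|$. For $f:\mathbb{R}^d\to\mathbb{R}$ let $r(f):=\inf\{r>0: f(x)\ge 0 \text{ for all } |x|\ge r\}$. $\mathcal A_+(d)$ is the set of $f:\mathbb{R}^d\to\mathbb{R}$ such that: $f\in L^1(\mathbb{R}^d)$, $\widehat f\in L^1(\mathbb{R}^d)$ and $\widehat f$ is real-valued (i.e. $f$ is even); $f$ is eventually nonnegative and $\widehat f(0)\le 0$; $\widehat f$ is eventually nonnegative and $f(0)\le 0$. Define $\mathbb{A}_+(d):=\inf\{\sqrt{r(f)r(\widehat f)}: f\in\mathcal A_+(d)\setminus\{0\}\}$. A function is bandlimited if its distributional Fourier transform has compact support. $\mathbb{A}_+^{\mathcal B}(d)$ is the same infimum restricted to bandlimited nonzero $f\in\mathcal A_+(d)$, and $\mathbb{A}_+^{\mathcal S}(d)$ is the same infimum restricted to nonzero $f\in\mathcal A_+(d)\cap\mathcal S(\mathbb{R}^d)$ (Schwartz class). *)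

(* Defs.v *)
From HB Require Import structures.
From mathcomp Require Import all_boot all_order all_algebra.
From mathcomp Require Import all_classical all_reals all_analysis.
Set Implicit Arguments. Unset Strict Implicit. Unset Printing Implicit Defensive.
Import Order.TTheory GRing.Theory Num.Theory.
Import numFieldNormedType.Exports.
Local Open Scope classical_set_scope.
Local Open Scope ring_scope.

Section SignUncertainty.
Context {R : realType}.

Definition leb := (@lebesgue_measure R).

Definition L1 (f : R -> R) : Prop := leb.-integrable setT (fun x => (f x)%:E).

(* Fourier transform  \hat f(xi) = \int f(x) e^{-2 pi i x xi} dx,
   split into real and imaginary parts (f is real-valued). *)
Definition FT_re (f : R -> R) (xi : R) : R :=
  Rintegral leb setT (fun x => f x * cos (2 * pi * x * xi)).
Definition FT_im (f : R -> R) (xi : R) : R :=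
  - Rintegral leb setT (fun x => f x * sin (2 * pi * x * xi)).

Definition eventually_nonneg (f : R -> R) : Prop :=
  exists r : R, forall x : R, r <= `|x| -> 0 <= f x.

Definition rsign (f : R -> R) : R :=
  inf [set r : R | 0 < r /\ forall x : R, r <= `|x| -> 0 <= f x].

(* The class A_+(1).  f is taken to be the continuous representative. When FT_im f = 0, FT_re f is \hat f. *)
Definition inAplus (f : R -> R) : Prop :=
  [/\ continuous f, L1 f /\ L1 (FT_re f), (forall xi, FT_im f xi = 0),
      eventually_nonneg f /\ FT_re f 0 <= 0 &
      eventually_nonneg (FT_re f) /\ f 0 <= 0].

(* bandlimited: (distributional) Fourier transform has compact support;
   for f in L^1 this is the function \hat f vanishing outside a bounded set. *)
Definition bandlimited (f : R -> R) : Prop :=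
  exists M : R, forall xi : R, M <= `|xi| -> FT_re f xi = 0 /\ FT_im f xi = 0.

Definition schwartz (f : R -> R) : Prop :=
  (forall (n : nat) (x : R), derivable (derive1n n f) x 1) /\
  (forall k n : nat, exists C : R, forall x : R,
      `|x| ^+ k * `|derive1n n f x| <= C).

Definition Aplus_const (P : (R -> R) -> Prop) : R :=
  inf [set Num.sqrt (rsign f * rsign (FT_re f)) |
       f in [set f : R -> R | inAplus f /\ (exists x, f x != 0) /\ P f]].

End SignUncertainty.

(* Main.v *)
Require Import Defs.
From mathcomp Require Import all_boot all_order all_algebra.
From mathcomp Require Import all_classical all_reals all_analysis.
From mathcomp Require Import measurable_realfun.
From mathcomp Require Import ring lra.
Set Implicit Arguments. Unset Strict Implicit. Unset Printing Implicit Defensive.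
Import Order.TTheory GRing.Theory Num.Theory.
Import numFieldNormedType.Exports.
Local Open Scope classical_set_scope.
Local Open Scope ring_scope.

(* Let f be in A_+(1), with f >= 0 outside [-r1, r1] and its transform >= 0 outside
   [-r2, r2]. After a dilation both radii are rho = sqrt (r1 r2), and the sum of f
   and its transform is a self-dual F0 (F0 is its own Fourier transform) with
   F0 >= 0 outside [-rho, rho] and F0 0 <= 0. It is not zero, because a function and
   its transform do not both have compact support.

   The operators f |-> f (l x) + f (x / l) / l and
   f |-> (f (x + a) + f (x - a)) / 2 + f x cos (2 pi a x) preserve self-duality.
   Combining them yields a self-dual F, nonnegative outside a slightly larger
   interval, with F 0 < 0; the margin at 0 allows adding a small self-dual function
   that decays exactly like 1 / x ^ 2, which gives a self-dual G with G 0 < 0 and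
   G x >= c / (1 + x ^ 2) outside the interval.

   Multiply G by the triangle function of a large width k. The product B has
   compact support and the sign conditions of G; its transform is the mean of G
   against the Fejer kernel, whose tail O(1 / (k x ^ 2)) is dominated by the lower
   bound of G. So the transform of B is a bandlimited competitor with almost the
   same radii. Multiplying it by a wide Gaussian gives a Schwartz competitor: B is
   then averaged against a narrow Gaussian, and the negative part of B in [-r, r]
   is beaten by its positive values just outside, which are closer. *)

(** Cutting off one side averages the other against a kernel. The transform of a compactly supported
    cutoff has no compact support itself, so the negative values near the origin leak to all
    distances, and the averaging also moves the value at 0. Weak inequalities would not survive
    this, so they are made strict and quantitative first.

    The strict sign at 0 comes from the translation operator, whose result at 0 is f a + f 0 for
    even f. A negative value f b exists, since a nonnegative f with integral f 0 <= 0 would vanish,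
    and translating by b brings it to the origin. The price: up to half of its size also appears,
    with negative sign, at points x just outside the interval, where x - b falls back inside. A
    translation by a large a pays for this. It costs f a at 0 and yields (f (a + x) + f (a - x)) / 2
    at x, so the balance closes if f (a + x) + f (a - x) >= C f a for small x, with some C > 1. Such
    an a exists wherever f is positive on a long interval, and dilations create that interval. *)

Notation Int := (Rintegral leb setT).

(** * Integration on the line: changes of variable, dominated convergence, fundamental theorem of
    calculus *)

Section IntegralCalculus.
Context {R : realType}.
Implicit Types f g h : R -> R.

Lemma L1_measurable f : L1 f -> measurable_fun setT f.
Proof. by move=> /integrableP[/measurable_EFinP]. Qed.

Lemma measurable_EFin_comp f : measurable_fun setT f ->
  measurable_fun (setT : set (measurableTypeR R)) (fun x => (f x)%:E).
Proof. by move=> mf; apply/measurable_EFinP. Qed.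

Lemma L1P f : L1 f <-> measurable_fun setT f /\ (\int[@leb R]_x `|(f x)%:E| < +oo)%E.
Proof.
split=> [lf|[mf foo]]; first by split; [exact: L1_measurable|case/integrableP: lf].
by apply/integrableP; split => //; exact: measurable_EFin_comp.
Qed.

Lemma L1_dominated f g : measurable_fun setT f -> L1 g ->
  (forall x, `|f x| <= g x) -> L1 f.
Proof.
move=> mf ig fg; apply: (le_integrable _ _ _ ig) => //.
  exact/measurable_EFinP.
by move=> x _; rewrite /= lee_fin (le_trans (fg x))// ler_norm.
Qed.

Lemma continuous_mfun f : continuous f -> measurable_fun setT f.
Proof. exact: continuous_measurable_fun. Qed.

Lemma L1_0 : L1 (fun _ : R => 0).
Proof. exact: integrable0. Qed.

Lemma L1D f g : L1 f -> L1 g -> L1 (fun x => f x + g x).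
Proof.
move=> lf lg; rewrite /L1; under eq_fun do rewrite EFinD.
exact: integrableD.
Qed.

Lemma L1Z (c : R) f : L1 f -> L1 (fun x => c * f x).
Proof.
move=> lf; rewrite /L1; under eq_fun do rewrite EFinM.
exact: integrableZl.
Qed.

Lemma L1N f : L1 f -> L1 (fun x => - f x).
Proof. by move=> /(L1Z (-1)); under eq_fun do rewrite mulN1r. Qed.

Lemma L1B f g : L1 f -> L1 g -> L1 (fun x => f x - g x).
Proof. by move=> lf lg; apply: L1D => //; exact: L1N. Qed.

Lemma L1_norm f : L1 f -> L1 (fun x => `|f x|).
Proof.
move=> lf; rewrite /L1.
rewrite (_ : (fun _ => _) = (abse \o (fun x => (f x)%:E))); last by apply/funext.
exact: integrable_abse.
Qed.

Lemma L1M_bounded f g (C : R) : L1 f -> measurable_fun setT g ->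
  (forall x, `|g x| <= C) -> L1 (fun x => f x * g x).
Proof.
move=> lf mg gC; apply: (@L1_dominated _ (fun x => C * `|f x|)).
- by apply: measurable_funM => //; exact: L1_measurable.
- by apply: L1Z; exact: L1_norm.
- by move=> x; rewrite normrM mulrC ler_wpM2r.
Qed.

Lemma IntD f g : L1 f -> L1 g -> Int (fun x => f x + g x) = Int f + Int g.
Proof. by move=> lf lg; rewrite RintegralD. Qed.

Lemma IntB f g : L1 f -> L1 g -> Int (fun x => f x - g x) = Int f - Int g.
Proof. by move=> lf lg; rewrite RintegralB. Qed.

Lemma IntZ (c : R) f : L1 f -> Int (fun x => c * f x) = c * Int f.
Proof. by move=> lf; rewrite RintegralZl. Qed.

Lemma IntN f : L1 f -> Int (fun x => - f x) = - Int f.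
Proof.
by move=> lf; rewrite -mulN1r -IntZ//; under [in RHS]eq_fun do rewrite mulN1r.
Qed.

Lemma Int_le f g : L1 f -> L1 g -> (forall x, f x <= g x) -> Int f <= Int g.
Proof. by move=> lf lg fg; apply: le_Rintegral. Qed.

Lemma Int_ge0 f : (forall x, 0 <= f x) -> 0 <= Int f.
Proof. by move=> f0; apply: Rintegral_ge0. Qed.

Lemma Int_norm f : L1 f -> `|Int f| <= Int (fun x => `|f x|).
Proof. by move=> lf; apply: le_normr_Rintegral. Qed.

Lemma Int0 : Int (fun _ : R => 0) = 0.
Proof. by rewrite Rintegral_cst// mul0r. Qed.

Lemma Int_EFin f : L1 f -> (\int[@leb R]_x (f x)%:E)%E = (Int f)%:E.
Proof. by move=> lf; rewrite /Rintegral fineK//; exact: integrable_fin_num. Qed.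

Lemma measurable_affine (c d : R) : measurable_fun setT (fun x : R => c * x + d).
Proof.
by apply: continuous_mfun => x; apply: cvgD; [apply: cvgM => //; exact: cvg_cst|exact: cvg_cst].
Qed.

(** Uniqueness of Lebesgue measure: [c] times its image under [x |-> c * x + d] agrees with it on
    half-open intervals. *)
Lemma ge0_integral_affine (c d : R) (F : R -> \bar R) : 0 < c ->
  measurable_fun setT F -> (forall x, (0 <= F x)%E) ->
  (\int[@leb R]_x F x = c%:E * \int[@leb R]_x F (c * x + d)%R)%E.
Proof.
move=> c0 mF F0.
pose phi : measurableTypeR R -> measurableTypeR R := fun x => c * x + d.
have mphi : measurable_fun setT phi by exact: measurable_affine.
pose k := NngNum (ltW c0).
pose pm : {measure set (measurableTypeR R) -> \bar R} :=
  measure_function_pushforward__canonical__measure_function_Measure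
    (@lebesgue_measure R) mphi.
transitivity (\int[mscale k pm]_x F x)%E.
  apply: eq_measure_integral => A mA _.
  apply: lebesgue_measure_unique => // _ [[a b]] _ <-.
  rewrite lebesgue_measure_itv/=.
  rewrite /mscale/= /pushforward.
  have -> : phi @^-1` `]a, b] = `](a - d) / c, (b - d) / c]%classic.
    apply/seteqP; split => x /=; rewrite !in_itv/= /phi;
      by rewrite ler_pdivlMr// ltr_pdivrMr// ltrBlDr lerBrDr mulrC.
  rewrite lebesgue_measure_itv/= !lte_fin ltr_pM2r ?invr_gt0// ltrD2r.
  case: ifPn => _; last by rewrite mule0.
  by rewrite -!EFinD -EFinM; congr EFin; field; rewrite gt_eqF.
rewrite ge0_integral_mscale// ge0_integral_pushforward//.
Qed.

Lemma ge0_integral_opp (F : R -> \bar R) :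
  measurable_fun setT F -> (forall x, (0 <= F x)%E) ->
  (\int[@leb R]_x F x = \int[@leb R]_x F (- x)%R)%E.
Proof.
move=> mF F0.
pose phi : measurableTypeR R -> measurableTypeR R := -%R.
have mphi : measurable_fun setT phi by exact: oppr_measurable.
transitivity (\int[pushforward (@lebesgue_measure R) phi]_x F x)%E.
  by apply: eq_measure_integral => A mA _; apply/esym; exact: lebesgue_measureN.
by rewrite ge0_integral_pushforward.
Qed.

Lemma measurable_comp_affine f (c d : R) : measurable_fun setT f ->
  measurable_fun setT (fun x => f (c * x + d)).
Proof. by move=> mf; apply: measurableT_comp => //; exact: measurable_affine. Qed.

Lemma L1_affine f (c d : R) : 0 < c -> L1 f -> L1 (fun x => f (c * x + d)).
Proof.
move=> c0 /L1P[mf foo]; apply/L1P; split; first exact: measurable_comp_affine.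
move: foo; rewrite (@ge0_integral_affine c d (fun x => `|(f x)%:E|%E))//; last first.
  by apply: measurableT_comp => //; exact/measurable_EFinP.
rewrite -lte_pdivlMl// => h; apply: lt_le_trans h _.
by rewrite leey.
Qed.

Lemma Int_affine f (c d : R) : 0 < c -> L1 f ->
  Int (fun x => f (c * x + d)) = c^-1 * Int f.
Proof.
move=> c0 lf; have lg := L1_affine d c0 lf.
apply: (@mulfI _ c); first by rewrite gt_eqF.
rewrite mulrA divff ?gt_eqF// mul1r.
apply: EFin_inj; rewrite EFinM -Int_EFin// -[RHS]Int_EFin//.
have mf := L1_measurable lf; have mE := (measurable_EFinP _ _).2 mf.
rewrite [RHS]integralE [in LHS]integralE.
rewrite (ge0_integral_affine d c0 (measurable_funepos mE)) ?funepos_ge0//.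
rewrite (ge0_integral_affine d c0 (measurable_funeneg mE)) ?funeneg_ge0//.
rewrite muleBr//; last exact: integrable_add_def lg.
by congr (_ * _ - _ * _)%E; apply: eq_integral => x _; rewrite ?funeposE ?funenegE.
Qed.

Lemma L1_opp f : L1 f -> L1 (fun x => f (- x)).
Proof.
move=> /L1P[mf foo]; apply/L1P; split.
  by apply: measurableT_comp => //; exact: oppr_measurable.
by rewrite -(@ge0_integral_opp (fun x => `|(f x)%:E|%E))//;
  apply: measurableT_comp => //; exact/measurable_EFinP.
Qed.

Lemma Int_opp f : L1 f -> Int (fun x => f (- x)) = Int f.
Proof.
move=> lf; congr fine.
have mf := L1_measurable lf; have mE := (measurable_EFinP _ _).2 mf.
rewrite [RHS]integralE [in LHS]integralE.
congr (_ - _)%E; rewrite [RHS]ge0_integral_opp//.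
- by apply: eq_integral => x _; rewrite ?funeposE ?funenegE.
- exact: measurable_funepos.
- by apply: eq_integral => x _; rewrite ?funeposE ?funenegE.
- exact: measurable_funeneg.
Qed.

Lemma L1_shift f (d : R) : L1 f -> L1 (fun x => f (x + d)).
Proof.
by move=> lf; have := L1_affine d ltr01 lf; under eq_fun do rewrite mul1r.
Qed.

Lemma Int_shift f (d : R) : L1 f -> Int (fun x => f (x + d)) = Int f.
Proof.
move=> lf; have := Int_affine d ltr01 lf.
by under eq_Rintegral do rewrite mul1r; rewrite invr1 mul1r.
Qed.

Lemma L1_dilate f (c : R) : 0 < c -> L1 f -> L1 (fun x => f (c * x)).
Proof.
by move=> c0 lf; have := L1_affine 0 c0 lf; under eq_fun do rewrite addr0.
Qed.

Lemma Int_dilate f (c : R) : 0 < c -> L1 f -> Int (fun x => f (c * x)) = c^-1 * Int f.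
Proof.
move=> c0 lf; have := Int_affine 0 c0 lf.
by under eq_Rintegral do rewrite addr0.
Qed.

Lemma Int_dominated_cvg (f_ : nat -> R -> R) f g :
  (forall n, measurable_fun setT (f_ n)) -> measurable_fun setT f -> L1 g ->
  (forall x, f_ n x @[n --> \oo] --> f x) -> (forall n x, `|f_ n x| <= g x) ->
  Int (f_ n) @[n --> \oo] --> Int f.
Proof.
move=> mf_ mf lg cf fg.
have [] := @dominated_convergence _ _ _ (@leb R) _ measurableT
   (fun n x => (f_ n x)%:E) (fun x => (f x)%:E) (fun x => (g x)%:E).
- by move=> n; exact: measurable_EFin_comp.
- exact: measurable_EFin_comp.
- apply: aeW => x _; apply: cvg_EFin; first exact: nearW.
  exact: cf.
- exact: lg.
- by apply: aeW => x n _; rewrite lee_fin.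
move=> lf _ c.
by apply: fine_cvg; rewrite -Int_EFin.
Qed.

Lemma integral_indic_itv (a b : R) : a <= b ->
  (\int[@leb R]_x (\1_(`[a, b]%classic) x)%:E = (b - a)%:E)%E.
Proof.
move=> ab; rewrite integral_indic//= ?setIT.
rewrite lebesgue_measure_itv/= lte_fin; case: ltP => //.
by move=> ba; have -> : a = b by [apply/eqP; rewrite eq_le ab ba]; rewrite subrr.
Qed.

Lemma L1_indic_itv (a b : R) : L1 (\1_(`[a, b]%classic) : R -> R).
Proof.
apply/L1P; split; first by apply: measurable_indic; exact: measurable_itv.
under eq_integral do rewrite gee0_abs ?lee_fin//.
have [ab|ba] := leP a b; first by rewrite integral_indic_itv// ltry.
rewrite set_itv_ge ?bnd_simp -?ltNge// indic0.
by rewrite integral0 ltry.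
Qed.

Lemma Int_indic_itv (a b : R) : a <= b ->
  Int (\1_(`[a, b]%classic) : R -> R) = b - a.
Proof. by move=> ab; rewrite /Rintegral integral_indic_itv. Qed.

Lemma Int_eq0 f : continuous f -> (forall x, 0 <= f x) -> L1 f -> Int f = 0 ->
  forall x, f x = 0.
Proof.
move=> cf f0 lf i0 x; apply/eqP; apply: contraT => fx0.
have fx : 0 < f x by rewrite lt_neqAle eq_sym fx0 f0.
have /cvgrPdist_lt/(_ (f x / 2)) := cf x.
rewrite divr_gt0// => /(_ isT) [e /= e0 He].
pose A : set R := `[x, x + e / 2]%classic.
have lA : L1 (fun y => f x / 2 * \1_A y).
  by apply: L1Z; exact: L1_indic_itv.
suff : 0 < Int f by rewrite i0 ltxx.
have le1 : Int (fun y => f x / 2 * \1_A y) <= Int f.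
  apply: Int_le => // y; rewrite indicE; case: (boolP (y \in A)); last first.
    by rewrite mulr0.
  rewrite inE /A /= in_itv/= => /andP[xy ye]; rewrite mulr1.
  have : `|f x - f y| < f x / 2.
    apply: He => /=; rewrite distrC ger0_norm ?subr_ge0//.
    by rewrite ltrBlDl (le_lt_trans ye)// ltrD2l; lra.
  by rewrite ltr_norml => /andP[_]; lra.
apply: lt_le_trans le1.
rewrite IntZ; last exact: L1_indic_itv.
by rewrite Int_indic_itv ?lerDl ?divr_ge0 ?ltW// mulr_gt0 ?divr_gt0//; lra.
Qed.

Lemma Int_restrict f (a b : R) : L1 f ->
  \int[@leb R]_(x in `[a, b]) f x = Int (fun x => f x * \1_(`[a, b]%classic) x).
Proof.
move=> lf; rewrite Rintegral_mkcond; apply: eq_Rintegral => x _.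
by rewrite patchE indicE; case: ifP; rewrite ?mulr1 ?mulr0.
Qed.

Lemma continuous_FTC f (F : R -> R) (a b : R) : a < b -> continuous f ->
  (forall x : R, is_derive x (1 : R) F (f x)) ->
  \int[@leb R]_(x in `[a, b]) f x = F b - F a.
Proof.
move=> ab cf dF; rewrite /Rintegral (@continuous_FTC2 _ f F)//.
- exact: continuous_subspaceT.
- have cF x : {for x, continuous F}.
    by apply: differentiable_continuous; apply/derivable1_diffP; have [] := dF x.
  split => //.
  + exact/cvg_at_right_filter/cF.
  + exact/cvg_at_left_filter/cF.
- by move=> x _; rewrite derive1E; have [_ ->] := dF x.
Qed.

Lemma Int_FTC f (F : R -> R) (A B : R) : L1 f -> continuous f ->
  (forall x : R, is_derive x (1 : R) F (f x)) ->
  F n%:R @[n --> \oo] --> A -> F (- n%:R) @[n --> \oo] --> B ->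
  Int f = A - B.
Proof.
move=> lf cf dF cA cB.
(* [n.+1] rather than [n] keeps the interval nondegenerate at [n = 0], as [continuous_FTC]
   requires. *)
pose f_ (n : nat) x := f x * \1_(`[- n.+1%:R, n.+1%:R]%classic) x.
have c1 : Int (f_ n) @[n --> \oo] --> Int f.
  apply: (@Int_dominated_cvg _ _ (fun x => `|f x|)).
  - move=> n; apply: measurable_funM; first exact: L1_measurable.
    by apply: measurable_indic; exact: measurable_itv.
  - exact: L1_measurable.
  - exact: L1_norm.
  - move=> x; apply: cvg_near_cst; near=> n.
    rewrite /f_ indicE mem_set ?mulr1//= in_itv/= -ler_norml.
    rewrite (@le_trans _ _ n%:R)// ?ler_nat//.
    by near: n; exact: nbhs_infty_ger.
  - move=> n x; rewrite /f_ normrM ler_piMr//.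
    by rewrite indicE; case: (_ \in _); rewrite /= ?normr1 ?normr0.
have c2 : Int (f_ n) @[n --> \oo] --> A - B.
  rewrite (_ : (fun n => _) = (fun n => F n.+1%:R - F (- n.+1%:R))).
    by apply: cvgB; [have := cA|have := cB]; rewrite -cvg_shiftS.
  apply/funext => n; rewrite -Int_restrict// (@continuous_FTC _ F)//.
  by rewrite ltrNl (@lt_trans _ _ 0)// oppr_lt0.
by apply: cvg_unique c1 c2.
Unshelve. all: by end_near. Qed.

End IntegralCalculus.

(** * Cosine and sine transforms of integrable functions *)

Section FourierBasics.
Context {R : realType}.
Implicit Types f g h : R -> R.

Lemma cos_2pi_measurable (xi : R) : measurable_fun setT (fun x : R => cos (2 * pi * x * xi)).
Proof.
apply: continuous_mfun => x; apply: continuous_comp; last exact: continuous_cos.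
by apply: cvgMl; apply: cvgMr; exact: cvg_id.
Qed.

Lemma sin_2pi_measurable (xi : R) : measurable_fun setT (fun x : R => sin (2 * pi * x * xi)).
Proof.
apply: continuous_mfun => x; apply: continuous_comp; last exact: continuous_sin.
by apply: cvgMl; apply: cvgMr; exact: cvg_id.
Qed.

Lemma norm_cos_le1 (x : R) : `|cos x| <= 1.
Proof. by rewrite ler_norml cos_geN1 cos_le1. Qed.

Lemma norm_sin_le1 (x : R) : `|sin x| <= 1.
Proof. by rewrite ler_norml sin_geN1 sin_le1. Qed.

Lemma L1_cos f (xi : R) : L1 f -> L1 (fun x => f x * cos (2 * pi * x * xi)).
Proof.
move=> lf; apply: (L1M_bounded lf (cos_2pi_measurable xi)) => x; exact: norm_cos_le1.
Qed.

Lemma L1_sin f (xi : R) : L1 f -> L1 (fun x => f x * sin (2 * pi * x * xi)).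
Proof.
move=> lf; apply: (L1M_bounded lf (sin_2pi_measurable xi)) => x; exact: norm_sin_le1.
Qed.

Lemma eq_Int f g : f =1 g -> Int f = Int g.
Proof. by move=> fg; apply: eq_Rintegral => x _. Qed.

Lemma FT_re_bound f (xi : R) : L1 f -> `|FT_re f xi| <= Int (fun x => `|f x|).
Proof.
move=> lf; apply: le_trans (Int_norm (L1_cos xi lf)) _.
apply: Int_le; [exact/L1_norm/L1_cos|exact: L1_norm|] => x.
by rewrite normrM ler_piMr// norm_cos_le1.
Qed.

Lemma FT_re_continuous f : L1 f -> continuous (FT_re f).
Proof.
move=> lf a.
apply: (@continuity_under_integral R _ _ (@leb R)
  (fun xi x => f x * cos (2 * pi * x * xi)) setT measurableT (a - 1) (a + 1)
  _ _ (fun x => `|f x|) _ _ a).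
- by move=> x _; exact: L1_cos.
- apply: aeW => y _ x _; apply: cvgMr.
  apply: continuous_comp; last exact: continuous_cos.
  by apply: cvgMr; exact: cvg_id.
- exact: L1_norm.
- move=> x _; apply: aeW => y _; rewrite normrM ler_piMr// norm_cos_le1//.
- by rewrite inE/= in_itv/=; apply/andP; split; lra.
Qed.

Lemma FT_reD f g : L1 f -> L1 g ->
  FT_re (fun x => f x + g x) = (fun xi => FT_re f xi + FT_re g xi).
Proof.
move=> lf lg; apply/funext => xi; rewrite /FT_re -IntD; [|exact: L1_cos..].
by apply: eq_Int => x; rewrite mulrDl.
Qed.

Lemma FT_reZ f (c : R) : L1 f ->
  FT_re (fun x => c * f x) = (fun xi => c * FT_re f xi).
Proof.
move=> lf; apply/funext => xi; rewrite /FT_re -IntZ; [|exact: L1_cos..].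
by apply: eq_Int => x; rewrite mulrA.
Qed.

Lemma FT_re_dilate f (c xi : R) : 0 < c -> L1 f ->
  FT_re (fun x => f (c * x)) xi = c^-1 * FT_re f (c^-1 * xi).
Proof.
move=> c0 lf; rewrite /FT_re -Int_dilate; [|by []|exact: L1_cos].
apply: eq_Int => x; congr (_ * cos _); field; exact: lt0r_neq0.
Qed.

Lemma FT_reN f (xi : R) : FT_re f (- xi) = FT_re f xi.
Proof. by apply: eq_Int => x; rewrite mulrN cosN. Qed.

Lemma FT_re_norm f (xi : R) : FT_re f `|xi| = FT_re f xi.
Proof. by case: (ger0P xi) => // _; rewrite FT_reN. Qed.

Lemma FT_im_even f (xi : R) : L1 f -> (forall x, f (- x) = f x) -> FT_im f xi = 0.
Proof.
move=> lf fe; have h : Int (fun x => f x * sin (2 * pi * x * xi)) =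
    - Int (fun x => f x * sin (2 * pi * x * xi)).
  rewrite -IntN; last exact: L1_sin.
  rewrite -Int_opp; last exact: L1_sin.
  by apply: eq_Int => x; rewrite fe mulrN mulNr sinN mulrN.
by rewrite /FT_im; lra.
Qed.

Lemma FT_re0 f : FT_re f 0 = Int f.
Proof. by apply: eq_Int => x; rewrite mulr0 cos0 mulr1. Qed.

Lemma FT_re_shift f (a xi : R) : L1 f ->
  FT_re (fun x => f (x + a)) xi =
  cos (2 * pi * a * xi) * FT_re f xi - sin (2 * pi * a * xi) * FT_im f xi.
Proof.
move=> lf; rewrite /FT_re /FT_im mulrN opprK -!IntZ; [|exact: L1_sin|exact: L1_cos].
rewrite -IntD; [|exact/L1Z/L1_cos|exact/L1Z/L1_sin].
rewrite -[RHS](Int_shift a); last first.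
  by apply: L1D; [exact/L1Z/L1_cos|exact/L1Z/L1_sin].
apply: eq_Int => x.
rewrite (_ : 2 * pi * x * xi = 2 * pi * (x + a) * xi - 2 * pi * a * xi); last by ring.
by rewrite cosB; ring.
Qed.

Lemma FT_re_mulcos f (a xi : R) : L1 f ->
  FT_re (fun x => f x * cos (2 * pi * x * a)) xi =
  (FT_re f (xi + a) + FT_re f (xi - a)) / 2.
Proof.
move=> lf; rewrite [RHS]mulrC /FT_re -IntD; [|exact: L1_cos..].
rewrite -IntZ; last by apply: L1D; exact: L1_cos.
apply: eq_Int => x.
rewrite (mulrDr _ xi a) cosD (mulrBr _ xi a) cosB.
set c1 := cos (2 * pi * x * a); set c2 := cos (2 * pi * x * xi); lra.
Qed.

End FourierBasics.

(** * Fubini, the multiplication formula and transforms of products *)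

Section FourierProducts.
Context {R : realType}.
Implicit Types (u v w : R -> R) (k : R -> R -> R).
Let T := measurableTypeR R.

Lemma measurable_fst_comp u : measurable_fun setT u ->
  measurable_fun setT (fun z : T * T => u z.1).
Proof. by move=> mu; apply: measurableT_comp => //; exact: measurable_fst. Qed.

Lemma measurable_snd_comp u : measurable_fun setT u ->
  measurable_fun setT (fun z : T * T => u z.2).
Proof. by move=> mu; apply: measurableT_comp => //; exact: measurable_snd. Qed.

Lemma integrable_prod_kernel u w k (C : R) : L1 u -> L1 w ->
  measurable_fun setT (fun z : T * T => k z.1 z.2) -> (forall x t, `|k x t| <= C) ->
  (@leb R \x @leb R)%E.-integrable setT (fun z : T * T => (u z.1 * w z.2 * k z.1 z.2)%:E).
Proof.
move=> lu lw mk kC.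
have C0 : 0 <= C by apply: le_trans (kC 0 0).
have mF : measurable_fun setT (fun z : T * T => u z.1 * w z.2 * k z.1 z.2).
  apply: measurable_funM => //; apply: measurable_funM.
    exact: (measurable_fst_comp (L1_measurable lu)).
  exact: (measurable_snd_comp (L1_measurable lw)).
have mN : measurable_fun setT (fun z : T * T => `|(u z.1 * w z.2 * k z.1 z.2)%:E|%E).
  by apply: measurableT_comp => //; exact/measurable_EFinP.
apply/integrable12ltyP; first exact/measurable_EFinP.
apply: (@le_lt_trans _ _ (\int[@leb R]_x ((C * Int (fun t => `|w t|)) * `|u x|)%:E)%E).
  apply: ge0_le_integral => //=.
  - by move=> x _; exact: integral_ge0.
  - apply: (@measurable_fun_fubini_tonelli_F _ _ T T R (@leb R)
      (fun z => `|(u z.1 * w z.2 * k z.1 z.2)%:E|%E)) => //=; exact: mN.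
  - apply/measurable_EFinP; apply: measurable_funM => //.
    by apply: measurableT_comp => //; exact: L1_measurable.
  move=> x _.
  have lx : L1 (fun t => (C * `|u x|) * `|w t|) by exact/L1Z/L1_norm.
  rewrite (_ : (C * _ * _)%R = Int (fun t => (C * `|u x|) * `|w t|)).
    rewrite -Int_EFin//; apply: ge0_le_integral => //=.
    - by have := measurableT_comp mN (measurable_pair1 x).
    - by apply: measurable_EFin_comp; exact: L1_measurable.
    move=> t _; rewrite lee_fin !normrM (mulrC C) mulrAC.
    by rewrite ler_wpM2r// ler_wpM2l.
  by rewrite IntZ; [ring|exact: L1_norm].
have l2 : L1 (fun x => C * Int (fun t => `|w t|) * `|u x|) by exact/L1Z/L1_norm.
by rewrite Int_EFin// ltry.
Qed.

Lemma Int_fubini u w k (C : R) : L1 u -> L1 w ->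
  measurable_fun setT (fun z : T * T => k z.1 z.2) -> (forall x t, `|k x t| <= C) ->
  Int (fun x => u x * Int (fun t => w t * k x t)) =
  Int (fun t => w t * Int (fun x => u x * k x t)).
Proof.
move=> lu lw mk kC.
have iF := integrable_prod_kernel lu lw mk kC.
have := Fubini iF => /= h.
have mk1 x : measurable_fun setT (k x).
  by have := measurableT_comp mk (measurable_pair1 x); exact.
have mk2 t : measurable_fun setT (k^~ t).
  by have := measurableT_comp mk (measurable_pair2 t); exact.
have l1 x : L1 (fun t => w t * k x t) by exact: (L1M_bounded lw (mk1 x) (kC x)).
have l2 t : L1 (fun x => u x * k x t) by apply: (L1M_bounded lu (mk2 t)) => x; exact: kC.
congr fine.
transitivity (\int[@leb R]_x \int[@leb R]_y (u x * w y * k x y)%:E)%E.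
  apply: eq_integral => x _; rewrite -IntZ// -Int_EFin; last exact: L1Z.
  by apply: eq_integral => y _; rewrite mulrA.
rewrite h; apply: eq_integral => y _; rewrite -IntZ// -Int_EFin; last exact: L1Z.
by apply: eq_integral => x _; congr EFin; ring.
Qed.

(** Tonelli with [xi] integrated first, where translation invariance makes the inner integral
    explicit. The bound on [v] makes the integrand integrable in [t] for every [xi], not just almost
    every one, so [Int] is exactly the function that Fubini provides. *)
Lemma L1_convolution w v (C : R) : L1 w -> L1 v -> (forall x, `|v x| <= C) ->
  L1 (fun xi => Int (fun t => w t * v (xi + t))).
Proof.
move=> lw lv vC.
pose F (z : T * T) := (w z.2 * v (z.1 + z.2))%:E.
have mF0 : measurable_fun setT (fun z : T * T => w z.2 * v (z.1 + z.2)).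
  apply: measurable_funM; first exact: (measurable_snd_comp (L1_measurable lw)).
  apply: (@measurableT_comp _ _ _ _ _ _ v); first exact: L1_measurable.
  by apply: measurable_funD; [exact: measurable_fst|exact: measurable_snd].
have mF : measurable_fun setT F by exact/measurable_EFinP.
have iF : (@leb R \x @leb R)%E.-integrable setT F.
  apply/integrable21ltyP => //.
  have E t : (\int[@leb R]_x `|F (x, t)| = (Int (fun x => `|v x|) * `|w t|)%:E)%E.
    have lvt := L1_shift t (L1_norm lv).
    rewrite -(Int_shift t (L1_norm lv)) mulrC -(IntZ _ lvt) -(Int_EFin (L1Z _ lvt)).
    by apply: eq_integral => x _; rewrite /F/= normrM.
  under eq_integral do rewrite E.
  rewrite Int_EFin ?ltry//; exact/L1Z/L1_norm.
have := integrable_fubini_F iF; rewrite /fubini_F /L1.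
congr (integrable _ _ _); apply/funext => x; rewrite -Int_EFin//.
apply: (L1M_bounded lw _ (fun t => vC (x + t))).
apply: (@measurableT_comp _ _ _ _ _ _ v); first exact: L1_measurable.
apply: continuous_mfun => y; apply: cvgD; [exact: cvg_cst|exact: cvg_id].
Qed.

Lemma cos_2pi_prod_measurable : measurable_fun setT (fun z : T * T => cos (2 * pi * z.1 * z.2) : R).
Proof.
apply: (@measurableT_comp _ _ _ _ _ _ cos).
  by apply: continuous_mfun => x; exact: continuous_cos.
apply: measurable_funM; last exact: measurable_snd.
by apply: measurable_funM => //; exact: measurable_fst.
Qed.

Lemma FT_re_adjoint u w : L1 u -> L1 w ->
  Int (fun x => u x * FT_re w x) = Int (fun t => w t * FT_re u t).
Proof.
move=> lu lw.
have kC (x t : R) : `|cos (2 * pi * x * t)| <= 1 by exact: norm_cos_le1.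
have h := @Int_fubini u w (fun x t => cos (2 * pi * x * t)) 1 lu lw cos_2pi_prod_measurable kC.
rewrite /FT_re -h; apply: eq_Int => x; congr (_ * _); apply: eq_Int => t.
by congr (_ * cos _); ring.
Qed.

Lemma FT_re_mul u w (xi : R) : L1 u -> L1 w ->
  FT_re (fun x => u x * FT_re w x) xi =
  Int (fun t => w t * ((FT_re u (t + xi) + FT_re u (t - xi)) / 2)).
Proof.
move=> lu lw.
have lu' := L1_cos xi lu.
transitivity (Int (fun x => (u x * cos (2 * pi * x * xi)) * FT_re w x)).
  by apply: eq_Int => x; ring.
rewrite FT_re_adjoint//; apply: eq_Int => t; congr (_ * _).
by rewrite FT_re_mulcos.
Qed.

Lemma L1_FT_re_mul u w : L1 u -> L1 w -> L1 (FT_re u) ->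
  L1 (FT_re (fun x => u x * FT_re w x)).
Proof.
move=> lu lw lu'.
have bu x : `|FT_re u x| <= Int (fun x => `|u x|) by exact: FT_re_bound.
have h1 := L1_convolution lw lu' bu.
have := L1Z 2^-1 (L1D h1 (L1_opp h1)); congr L1; apply/funext => xi.
have mu : measurable_fun setT (FT_re u) by exact: L1_measurable.
have l1 (a : R) : L1 (fun t => w t * FT_re u (t + a)).
  apply: (L1M_bounded lw _ (fun t => bu (t + a))).
  by have := measurable_comp_affine 1 a mu; under eq_fun do rewrite mul1r.
rewrite FT_re_mul//= -IntD; last 2 first.
- by under eq_fun do rewrite addrC.
- by under eq_fun do rewrite addrC.
rewrite -IntZ; last by apply: L1D; under eq_fun do rewrite addrC.
by apply: eq_Int => t; rewrite (addrC xi) (addrC (- xi)); ring.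
Qed.

End FourierProducts.

(** * The Gaussian is its own Fourier transform *)

Section Gaussian.
Context {R : realType}.
Implicit Types (u v w : R -> R).

Lemma is_derive_FT_re w (xi : R) : L1 w -> L1 (fun x => x * w x) ->
  is_derive xi (1 : R) (FT_re w) (2 * pi * FT_im (fun x => x * w x) xi).
Proof.
move=> lw lxw.
have d1 (x y : R) : is_derive x (1 : R) (fun xi => w y * cos (2 * pi * y * xi))
    (- (2 * pi) * (y * w y * sin (2 * pi * y * x))).
  apply: is_derive_eq; rewrite /GRing.scale/=; ring.
have lG : L1 (fun y => 2 * pi * `|y * w y|) by exact/L1Z/L1_norm.
have Ia : `](xi - 1), (xi + 1)[%classic xi.
  by rewrite /= in_itv/=; apply/andP; split; lra.
have Gub (x y : R) : `|partial1of2 (fun xi y => w y * cos (2 * pi * y * xi)) x y| <=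
    2 * pi * `|y * w y|.
  rewrite partial1of2E (@derive_val _ _ _ _ _ _ _ (d1 x y)) normrM normrN.
  rewrite (ger0_norm (_ : 0 <= 2 * pi)) ?mulr_ge0 ?pi_ge0//.
  apply: ler_wpM2l; first by rewrite mulr_ge0 ?pi_ge0.
  by rewrite normrM ler_piMr// norm_sin_le1.
have G0 (y : R) : 0 <= 2 * pi * `|y * w y| by rewrite !mulr_ge0 ?pi_ge0.
pose F (xi y : R) := w y * cos (2 * pi * y * xi).
have intF (x : R) : `](xi - 1), (xi + 1)[%classic x ->
    (@leb R).-integrable setT (EFin \o F x) by move=> _; exact: L1_cos.
have derF (x y : R) : `](xi - 1), (xi + 1)[%classic x -> [set: R] y ->
    derivable (F ^~ y) x 1 by move=> _ _; have [] := d1 x y.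
have ubF (x y : R) : `](xi - 1), (xi + 1)[%classic x -> [set: R] y ->
    `|partial1of2 F x y| <= 2 * pi * `|y * w y| by move=> _ _; exact: Gub.
apply: DeriveDef.
  exact: (derivable_under_integral measurableT Ia intF derF G0 lG ubF).
rewrite -derive1E (differentiation_under_integral measurableT Ia intF derF G0 lG ubF).
rewrite /FT_im mulrN -mulNr -IntZ; last exact: L1_sin.
apply: eq_Int => y.
by rewrite partial1of2E (@derive_val _ _ _ _ _ _ _ (d1 xi y)).
Qed.

Lemma is_derive_FT_im w (xi : R) : L1 w -> L1 (fun x => x * w x) ->
  is_derive xi (1 : R) (FT_im w) (- (2 * pi * FT_re (fun x => x * w x) xi)).
Proof.
move=> lw lxw.
suff h : is_derive xi (1 : R) (fun xi => Int (fun x => w x * sin (2 * pi * x * xi)))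
    (2 * pi * FT_re (fun x => x * w x) xi).
  exact: is_deriveN.
have d1 (x y : R) : is_derive x (1 : R) (fun xi => w y * sin (2 * pi * y * xi))
    (2 * pi * (y * w y * cos (2 * pi * y * x))).
  apply: is_derive_eq; rewrite /GRing.scale/=; ring.
have lG : L1 (fun y => 2 * pi * `|y * w y|) by exact/L1Z/L1_norm.
have Ia : `](xi - 1), (xi + 1)[%classic xi.
  by rewrite /= in_itv/=; apply/andP; split; lra.
have Gub (x y : R) : `|partial1of2 (fun xi y => w y * sin (2 * pi * y * xi)) x y| <=
    2 * pi * `|y * w y|.
  rewrite partial1of2E (@derive_val _ _ _ _ _ _ _ (d1 x y)) normrM.
  rewrite (ger0_norm (_ : 0 <= 2 * pi)) ?mulr_ge0 ?pi_ge0//.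
  apply: ler_wpM2l; first by rewrite mulr_ge0 ?pi_ge0.
  by rewrite normrM ler_piMr// norm_cos_le1.
have G0 (y : R) : 0 <= 2 * pi * `|y * w y| by rewrite !mulr_ge0 ?pi_ge0.
pose F (xi y : R) := w y * sin (2 * pi * y * xi).
have intF (x : R) : `](xi - 1), (xi + 1)[%classic x ->
    (@leb R).-integrable setT (EFin \o F x) by move=> _; exact: L1_sin.
have derF (x y : R) : `](xi - 1), (xi + 1)[%classic x -> [set: R] y ->
    derivable (F ^~ y) x 1 by move=> _ _; have [] := d1 x y.
have ubF (x y : R) : `](xi - 1), (xi + 1)[%classic x -> [set: R] y ->
    `|partial1of2 F x y| <= 2 * pi * `|y * w y| by move=> _ _; exact: Gub.
apply: DeriveDef.
  exact: (derivable_under_integral measurableT Ia intF derF G0 lG ubF).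
rewrite -derive1E (differentiation_under_integral measurableT Ia intF derF G0 lG ubF).
rewrite /FT_re -IntZ; last exact: L1_cos.
apply: eq_Int => y.
by rewrite partial1of2E (@derive_val _ _ _ _ _ _ _ (d1 xi y)).
Qed.

Definition gau (x : R) : R := expR (- (pi * x ^+ 2)).

Lemma gau_gt0 x : 0 < gau x. Proof. exact: expR_gt0. Qed.

Lemma gauN x : gau (- x) = gau x. Proof. by rewrite /gau sqrrN. Qed.

Lemma gau0 : gau 0 = 1. Proof. by rewrite /gau expr0n mulr0 oppr0 expR0. Qed.

Lemma gau_le1 x : gau x <= 1.
Proof. by rewrite /gau -expR0 ler_expR oppr_le0 mulr_ge0 ?pi_ge0 ?sqr_ge0. Qed.

#[global] Instance is_derive_gau (x : R) : is_derive x (1 : R) gau (- (2 * pi * x) * gau x).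
Proof.
rewrite /gau; apply: is_derive_eq; rewrite /GRing.scale/=; ring.
Qed.

Lemma gau_continuous : continuous gau.
Proof.
move=> x; apply: differentiable_continuous; apply/derivable1_diffP.
by have [] := is_derive_gau x.
Qed.

Lemma gau_gaussE x : gau x = gauss_fun (Num.sqrt pi * x).
Proof. by rewrite /gau /gauss_fun exprMn sqr_sqrtr// pi_ge0. Qed.

Lemma L1_gau : L1 gau.
Proof.
rewrite (_ : gau = fun x => gauss_fun (Num.sqrt pi * x)); last first.
  by apply/funext => x; rewrite gau_gaussE.
by apply: L1_dilate; [rewrite sqrtr_gt0 pi_gt0|exact: integrableT_gauss].
Qed.

Lemma Int_gau : Int gau = 1.
Proof.
have -> : Int gau = Int (fun x => gauss_fun (Num.sqrt pi * x)).
  by apply: eq_Int => x; rewrite gau_gaussE.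
rewrite Int_dilate; [|by rewrite sqrtr_gt0 pi_gt0|exact: integrableT_gauss].
rewrite /Rintegral integralT_gauss/= mulVf// gt_eqF// sqrtr_gt0 pi_gt0//.
Qed.

(* [|x| <= (1 + x ^ 2) / 2 <= exp (pi x^2 / 2)] absorbs the factor [x]. *)
Lemma norm_mul_gau_le (x : R) : `|x * gau x| <= gau ((Num.sqrt 2)^-1 * x).
Proof.
have -> : gau ((Num.sqrt 2)^-1 * x) = expR (pi * x ^+ 2 / 2) * gau x.
  rewrite /gau -expRD exprMn exprVn sqr_sqrtr//; congr expR; lra.
rewrite normrM (ger0_norm (ltW (gau_gt0 x))) ler_wpM2r ?(ltW (gau_gt0 x))//.
apply: le_trans (expR_ge1Dx _).
have h1 : 0 <= (1 - `|x|) ^+ 2 by exact: sqr_ge0.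
have h2 : 0 <= (pi - 2) * x ^+ 2 by rewrite mulr_ge0 ?sqr_ge0// subr_ge0 pi_ge2.
have h3 : `|x| ^+ 2 = x ^+ 2 by rewrite real_normK ?num_real.
nra.
Qed.

Lemma L1_mul_gau : L1 (fun x => x * gau x).
Proof.
apply: (@L1_dominated _ _ (fun x => gau ((Num.sqrt 2)^-1 * x))).
- apply: measurable_funM; first exact: measurable_id.
  exact: (continuous_mfun gau_continuous).
- by apply: L1_dilate; [rewrite invr_gt0 sqrtr_gt0|exact: L1_gau].
- exact: norm_mul_gau_le.
Qed.

Lemma gau_le_inv (x : R) : (1 + x ^+ 2) * gau x <= 1.
Proof.
have : 1 + x ^+ 2 <= expR (pi * x ^+ 2).
  apply: le_trans (expR_ge1Dx _); rewrite lerD2l ler_peMl ?sqr_ge0//.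
  by apply: le_trans (pi_ge2 R); rewrite ler1n.
rewrite /gau expRN ler_pdivrMr ?expR_gt0//; lra.
Qed.

Lemma cvg_gau_infty : gau n%:R @[n --> \oo] --> (0 : R).
Proof.
apply: (@squeeze_cvgr _ _ _ _ (fun=> 0) (fun n => n.+1%:R^-1)).
- near=> n; rewrite (ltW (gau_gt0 _))/=.
  have := gau_le_inv n%:R; rewrite -natrX.
  have g0 := gau_gt0 (n%:R : R).
  have h : n.+1%:R <= 1 + (n ^ 2)%:R :> R.
    by rewrite -natr1 addrC lerD2l ler_nat; case: (n) => // m; rewrite expnS leq_pmulr// expn_gt0.
  move=> le1; rewrite -[leRHS]mul1r ler_pdivlMr// mulrC.
  by apply: le_trans le1; rewrite ler_wpM2r// ltW.
- exact: cvg_cst.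
- exact: cvg_harmonic.
Unshelve. all: by end_near. Qed.

(** The derivative of [gau y * sin (2 * pi * y * x)] in [y] has integral 0, which turns the
    derivative of the transform into [- 2 pi x] times the transform. Hence
    [FT_re gau x * expR (pi * x ^+ 2)] is constant, and at 0 it equals [Int gau = 1]. *)
Lemma FT_re_gau (xi : R) : FT_re gau xi = gau xi.
Proof.
have ode (x : R) : FT_im (fun y => y * gau y) x = - (x * FT_re gau x).
  have d (y : R) : is_derive y (1 : R) (fun y => gau y * sin (2 * pi * y * x))
     (2 * pi * (x * (gau y * cos (2 * pi * y * x)) - y * gau y * sin (2 * pi * y * x))).
    have := is_derive_gau y => dg.
    apply: is_derive_eq; rewrite /GRing.scale/=; ring.
  have lc := L1Z x (L1_cos x L1_gau); have ls := L1_sin x L1_mul_gau.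
  have cg (f : nat -> R) : (forall n, `|f n| <= gau n%:R) -> f n @[n --> \oo] --> (0 : R).
    move=> h; apply: norm_cvg0; apply: (@squeeze_cvgr _ _ _ _ (fun=> 0) (fun n => gau n%:R)).
    - by apply: nearW => n; rewrite normr_ge0 h.
    - exact: cvg_cst.
    - exact: cvg_gau_infty.
  have c : continuous (fun y => 2 * pi * (x * (gau y * cos (2 * pi * y * x))
      - y * gau y * sin (2 * pi * y * x))).
    move=> y; apply: differentiable_continuous; apply/derivable1_diffP; exact: ex_derive.
  have := @Int_FTC _ _ _ 0 0 (L1Z (2 * pi) (L1B lc ls)) c d.
  rewrite subr0 IntZ; last exact: L1B.
  rewrite IntB// IntZ; last exact: (L1_cos x L1_gau).
  rewrite -/(FT_re gau x) => h; rewrite /FT_im.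
  have /eqP : 2 * pi * (x * FT_re gau x - Int (fun y => y * gau y * sin (2 * pi * y * x))) = 0.
    apply: h; apply: cg => n; rewrite normrM ger0_norm ?(ltW (gau_gt0 _))//.
      by rewrite ler_piMr ?(ltW (gau_gt0 _))// norm_sin_le1.
    by rewrite gauN ler_piMr ?(ltW (gau_gt0 _))// norm_sin_le1.
  rewrite mulf_eq0 gt_eqF ?mulr_gt0 ?pi_gt0//= subr_eq0 => /eqP <-//.
have dF (x : R) : is_derive x (1 : R) (fun x => FT_re gau x * expR (pi * x ^+ 2)) 0.
  have := is_derive_FT_re x L1_gau L1_mul_gau; rewrite ode => dg.
  apply: is_derive_eq; rewrite /GRing.scale/=; ring.
have := @is_derive_0_is_cst R _ xi 0 dF.
rewrite expr0n/= mulr0 expR0 mulr1 FT_re0 Int_gau => h.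
apply: (@mulIf _ (expR (pi * xi ^+ 2))); first by rewrite gt_eqF ?expR_gt0.
by rewrite h /gau -expRD addrC subrr expR0.
Qed.

End Gaussian.

(** * Approximate identities and Fourier inversion *)

Section Inversion.
Context {R : realType}.
Implicit Types (f phi : R -> R).

Lemma one_sqr_gt0 (x : R) : 0 < 1 + x ^+ 2.
Proof. by rewrite ltr_wpDr ?sqr_ge0. Qed.

Lemma L1_inv_one_sqr : L1 (fun x : R => (1 + x ^+ 2)^-1).
Proof.
have c : continuous (fun x : R => (1 + x ^+ 2)^-1) by exact: continuous_oneDsqrV.
apply/L1P; split; first exact: (continuous_mfun c).
under eq_integral do rewrite gee0_abs ?lee_fin ?invr_ge0 ?(ltW (one_sqr_gt0 _))//.
rewrite (@ge0_symfun_integralT R (fun x => (1 + x ^+ 2)^-1))//; last 2 first.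
- by move=> x; rewrite invr_ge0 ltW ?one_sqr_gt0.
- by move=> x /=; rewrite sqrrN.
rewrite -set_itvcy.
have -> := @integral0y_oneDsqr R.
by rewrite -EFinM ltry.
Qed.

Lemma L1_le_inv_one_sqr phi (C : R) : measurable_fun setT phi ->
  (forall x, 0 <= phi x) -> (forall x, phi x <= C / (1 + x ^+ 2)) -> L1 phi.
Proof.
move=> mphi phi0 phiC; apply: (L1_dominated mphi (L1Z C L1_inv_one_sqr)) => x.
by rewrite ger0_norm.
Qed.

(** The scaled kernel is at most [C / (k * x ^+ 2)], and off [[-d, d]] the inverse square is at most
    [1 + d ^- 2] times the integrable [(1 + x ^+ 2)^-1]. *)
Lemma kernel_tail phi (C d k x : R) : (forall x, phi x <= C / (1 + x ^+ 2)) ->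
  0 <= C -> 0 < d -> 0 < k -> d <= `|x| ->
  k * phi (k * x) <= C * (1 + d ^- 2) / k * (1 + x ^+ 2)^-1.
Proof.
move=> phiC C0 d0 k0 dx.
apply: (@le_trans _ _ (k * (C / (1 + (k * x) ^+ 2)))); first by rewrite ler_wpM2l ?(ltW k0).
have x2 : d ^+ 2 <= x ^+ 2.
  by rewrite -(real_normK (num_real x)) ler_sqr ?nnegrE ?(ltW d0).
have xx : 0 < x ^+ 2 by apply: lt_le_trans x2; rewrite exprn_gt0.
have h1 : (1 + (k * x) ^+ 2)^-1 <= (k ^+ 2 * x ^+ 2)^-1.
  rewrite -exprMn lef_pV2 ?posrE ?one_sqr_gt0 ?lerDr//.
  by rewrite exprMn; apply: mulr_gt0 => //; exact: exprn_gt0.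
apply: (@le_trans _ _ (k * (C / (k ^+ 2 * x ^+ 2)))).
  by rewrite ler_wpM2l ?(ltW k0)// ler_wpM2l.
have h2 : (x ^+ 2)^-1 <= (1 + d ^- 2) * (1 + x ^+ 2)^-1.
  rewrite ler_pdivlMr ?one_sqr_gt0// mulrDr mulr1 mulVf ?gt_eqF// addrC lerD2l.
  by rewrite lef_pV2 ?posrE//; exact: exprn_gt0.
have -> : k * (C / (k ^+ 2 * x ^+ 2)) = C / k * (x ^+ 2)^-1.
  field; rewrite (gt_eqF k0) andbT; apply: contraTneq xx => ->.
  by rewrite expr0n ltxx.
rewrite (_ : C * (1 + d ^- 2) / k * (1 + x ^+ 2)^-1 =
   C / k * ((1 + d ^- 2) * (1 + x ^+ 2)^-1)); last by ring.
by rewrite ler_wpM2l// divr_ge0// ltW.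
Qed.

Lemma Int_scaled phi (k : R) : 0 < k -> L1 phi -> Int (fun x => k * phi (k * x)) = Int phi.
Proof.
move=> k0 lphi; rewrite IntZ; last exact: L1_dilate.
by rewrite Int_dilate// mulrA divff ?gt_eqF// mul1r.
Qed.

(** Here [f] may be unbounded, so smallness of the kernel's tail mass would not do. The quadratic
    decay makes the tail uniformly [O(1 / k)], which can be paired with [f] in L^1. *)
Lemma approximate_identity phi (C : R) f (e : R) :
  measurable_fun setT phi -> (forall x, 0 <= phi x) ->
  (forall x, phi x <= C / (1 + x ^+ 2)) -> Int phi = 1 ->
  L1 f -> {for 0, continuous f} -> 0 < e ->
  exists k0, 0 < k0 /\ forall k, k0 <= k ->
    `|Int (fun x => f x * (k * phi (k * x))) - f 0| <= e.
Proof.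
move=> mphi phi0 phiC iphi lf cf e0.
have lphi := L1_le_inv_one_sqr mphi phi0 phiC.
have C0 : 0 <= C.
  by have := le_trans (phi0 0) (phiC 0); rewrite expr0n addr0 divr1.
have e20 : 0 < e / 2 by rewrite divr_gt0.
have /cvgrPdist_lt/(_ _ e20) [d /= d0 Hd] := cf.
pose C' := C * (1 + d ^- 2).
have C'0 : 0 <= C' by rewrite mulr_ge0// addr_ge0// invr_ge0 sqr_ge0.
pose J := Int (fun x => `|f x|) + `|f 0| * Int (fun x : R => (1 + x ^+ 2)^-1).
have J0 : 0 <= J.
  rewrite addr_ge0 ?mulr_ge0// ?Int_ge0// => x.
  by rewrite invr_ge0 ltW ?one_sqr_gt0.
(* The threshold [2 * C' * J / e] brings the tail part [C' / k * J] below [e / 2]; the summand 1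
   added to it keeps [k0] positive even if [J = 0]. *)
have P0 : 0 <= 2 * C' * J / e by rewrite divr_ge0 ?(ltW e0)// mulr_ge0// mulr_ge0.
exists (1 + 2 * C' * J / e); split.
  by rewrite ltr_wpDr.
move=> k hk.
have k0 : 0 < k.
  by apply: lt_le_trans hk; rewrite ltr_wpDr.
have lk : L1 (fun x => k * phi (k * x)) by exact/L1Z/L1_dilate.
have bk (x : R) : `|k * phi (k * x)| <= k * C.
  rewrite ger0_norm ?mulr_ge0 ?(ltW k0)// ler_wpM2l ?(ltW k0)//.
  apply: le_trans (phiC _) _; rewrite ler_pdivrMr ?one_sqr_gt0//.
  by rewrite ler_peMr// lerDl sqr_ge0.
have lfk : L1 (fun x => f x * (k * phi (k * x))).
  by apply: (L1M_bounded lf (L1_measurable lk) bk).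
have -> : f 0 = Int (fun x => f 0 * (k * phi (k * x))).
  by rewrite IntZ// Int_scaled// iphi mulr1.
rewrite -IntB//; last exact: L1Z.
apply: le_trans (Int_norm (L1B lfk (L1Z _ lk))) _.
(* The first summand is the majorant on [|x| < d], by continuity at 0, and the second one elsewhere,
   by [kernel_tail]; adding them avoids splitting the domain. *)
pose g x := e / 2 * (k * phi (k * x)) +
   C' / k * (`|f x| + `|f 0| * (1 + x ^+ 2)^-1).
have lg2 : L1 (fun x => `|f x| + `|f 0| * (1 + x ^+ 2)^-1).
  by apply: L1D; [exact: L1_norm|exact/L1Z/L1_inv_one_sqr].
have lg : L1 g by apply: L1D; exact: L1Z.
apply: (@le_trans _ _ (Int g)).
  apply: Int_le => //; first exact/L1_norm/L1B/L1Z.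
  move=> x; rewrite -mulrBl normrM (ger0_norm (mulr_ge0 (ltW k0) (phi0 _))).
  have p0 : 0 <= k * phi (k * x) by rewrite mulr_ge0 ?(ltW k0).
  have q0 : 0 <= (1 + x ^+ 2)^-1 by rewrite invr_ge0 ltW ?one_sqr_gt0.
  have q1 : (1 + x ^+ 2)^-1 <= 1 by rewrite invf_le1 ?one_sqr_gt0// lerDl sqr_ge0.
  have [xd|dx] := ltP `|x| d.
    apply: (@le_trans _ _ (e / 2 * (k * phi (k * x)))).
      rewrite ler_wpM2r// distrC ltW// Hd//=.
      by rewrite sub0r normrN.
    by rewrite lerDl mulr_ge0 ?divr_ge0 ?(ltW k0)// addr_ge0// mulr_ge0.
  apply: (@le_trans _ _ (C' / k * (`|f x| + `|f 0| * (1 + x ^+ 2)^-1))); last first.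
    by rewrite lerDr mulr_ge0// ltW.
  have ht := kernel_tail phiC C0 d0 k0 dx; rewrite -/C' in ht.
  have c0 : 0 <= C' / k by rewrite divr_ge0// (ltW k0).
  apply: (@le_trans _ _ ((`|f x| + `|f 0|) * (C' / k * (1 + x ^+ 2)^-1))).
    by apply: ler_pM => //; exact: ler_normB.
  rewrite mulrCA ler_wpM2l// mulrDl lerD2r.
  by rewrite ler_piMr.
rewrite IntD; [|exact: L1Z|exact: L1Z].
rewrite (IntZ _ lk) (IntZ _ lg2) Int_scaled// iphi mulr1 IntD; [|exact: L1_norm|exact/L1Z/L1_inv_one_sqr].
rewrite IntZ; last exact: L1_inv_one_sqr.
rewrite -/J.
suff : C' / k * J <= e / 2 by move: (C' / k * J) => z; lra.
have : 2 * C' * J / e <= k by apply: le_trans hk; rewrite lerDr.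
rewrite ler_pdivrMr// => h.
by rewrite (_ : C' / k * J = C' * J / k) ?ler_pdivrMr//; [lra|ring].
Qed.

Lemma gau_le_quadratic (x : R) : gau x <= 1 / (1 + x ^+ 2).
Proof. by rewrite ler_pdivlMr ?one_sqr_gt0// mulrC gau_le_inv. Qed.

Lemma FT_re_gau_dilate (k xi : R) : 0 < k ->
  FT_re (fun x => gau (k^-1 * x)) xi = k * gau (k * xi).
Proof.
move=> k0; rewrite FT_re_dilate ?invr_gt0//; last exact: L1_gau.
by rewrite invrK FT_re_gau.
Qed.

(** Gaussian summation: integrate [FT_re f] against ever wider Gaussians. Dominated convergence
    gives the left side; the adjoint formula turns the same integrals into means of [f] against ever
    narrower Gaussians. *)
Lemma Int_FT_re f : L1 f -> {for 0, continuous f} -> L1 (FT_re f) -> Int (FT_re f) = f 0.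
Proof.
move=> lf cf lff.
pose a (n : nat) := Int (fun x => gau (n.+1%:R^-1 * x) * FT_re f x).
have lgn (n : nat) : L1 (fun x : R => gau (n.+1%:R^-1 * x)).
  by apply: L1_dilate; [rewrite invr_gt0|exact: L1_gau].
have c1 : a n @[n --> \oo] --> Int (FT_re f).
  apply: (@Int_dominated_cvg R _ _ (fun x => `|FT_re f x|)).
  - by move=> n; apply: measurable_funM; apply: L1_measurable.
  - exact: L1_measurable.
  - exact: L1_norm.
  - move=> x; rewrite -[X in _ --> X]mul1r; apply: cvgM; last exact: cvg_cst.
    rewrite [X in _ --> X](_ : 1 = gau (0 * x)); last by rewrite mul0r gau0.
    apply: (@continuous_cvg _ _ _ _ _ _ gau); first exact: gau_continuous.
    by apply: cvgM; [exact: cvg_harmonic|exact: cvg_cst].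
  - move=> n x; rewrite normrM ger0_norm ?(ltW (gau_gt0 _))//.
    by rewrite ler_piMl// gau_le1.
have aE n : a n = Int (fun x => f x * (n.+1%:R * gau (n.+1%:R * x))).
  rewrite /a FT_re_adjoint//; apply: eq_Int => x.
  by rewrite FT_re_gau_dilate.
have c2 : a n @[n --> \oo] --> f 0.
  apply/cvgrPdist_le => e e0.
  have [||k0 [k00 hk]] := @approximate_identity gau 1 f e _ _ gau_le_quadratic Int_gau lf cf e0.
  - exact: (continuous_mfun gau_continuous).
  - by move=> x; exact/ltW/gau_gt0.
  near=> n; rewrite distrC aE hk//.
  rewrite (@le_trans _ _ n%:R)// ?ler_nat//.
  by near: n; exact: nbhs_infty_ger.
exact: cvg_unique c1 c2.
Unshelve. all: by end_near. Qed.

(** Inversion at [a] is inversion at 0 for the translate by [a], whose cosine transform is just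
    [FT_re f] times a cosine because [FT_im f] vanishes. *)
Lemma FT_re_inversion f : continuous f -> L1 f -> L1 (FT_re f) ->
  (forall xi, FT_im f xi = 0) -> FT_re (FT_re f) = f.
Proof.
move=> cf lf lff im0; apply/funext => a.
have E : FT_re (fun x => f (x + a)) = fun xi => FT_re f xi * cos (2 * pi * xi * a).
  apply/funext => xi; rewrite FT_re_shift// im0 mulr0 subr0 mulrC.
  by congr (_ * cos _); ring.
rewrite -[in RHS](add0r a) -(@Int_FT_re (fun x => f (x + a))).
- by rewrite E.
- exact: L1_shift.
- apply: continuous_comp; last exact: cf.
  by apply: cvgD; [exact: cvg_id|exact: cvg_cst].
- by rewrite E; exact: L1_cos.
Qed.

End Inversion.

(** * Self-dual functions, and functions compactly supported together with their transform *)

Section SelfDual.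
Context {R : realType}.
Implicit Types (f g u : R -> R).

(** The cosine part suffices: [FT_re f = f] makes [f] even, and then [FT_im f] is zero. *)
Definition selfdual f := [/\ continuous f, L1 f & FT_re f = f].

Lemma selfdual_even f : selfdual f -> forall x, f (- x) = f x.
Proof. by move=> [_ _ ff] x; rewrite -{1}ff FT_reN ff. Qed.

Lemma selfdual_norm f : selfdual f -> forall x, f `|x| = f x.
Proof. by move=> [_ _ ff] x; rewrite -{1}ff FT_re_norm ff. Qed.

Lemma selfdual_bound f : selfdual f -> forall x, `|f x| <= Int (fun x => `|f x|).
Proof. by move=> [_ lf ff] x; rewrite -{1}ff FT_re_bound. Qed.

Lemma selfdual0 : selfdual (fun=> 0).
Proof.
split; [by move=> x; exact: cvg_cst|exact: L1_0|].
apply/funext => x; rewrite -[RHS](@Int0 R); apply: eq_Int => y; exact: mul0r.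
Qed.

Lemma selfdualD f g : selfdual f -> selfdual g -> selfdual (fun x => f x + g x).
Proof.
move=> [cf lf ff] [cg lg gg]; split.
- by move=> x; apply: cvgD; [exact: cf|exact: cg].
- exact: L1D.
- by rewrite FT_reD// ff gg.
Qed.

Lemma selfdualZ (c : R) f : selfdual f -> selfdual (fun x => c * f x).
Proof.
move=> [cf lf ff]; split.
- by move=> x; apply: cvgMr; exact: cf.
- exact: L1Z.
- by rewrite FT_reZ// ff.
Qed.

Lemma selfdual_sum (n : nat) (F : nat -> R -> R) : (forall i, selfdual (F i)) ->
  selfdual (fun x => \sum_(i < n) F i x).
Proof.
move=> sF; elim: n => [|n IH].
  by under eq_fun do rewrite big_ord0; exact: selfdual0.
by under eq_fun do rewrite big_ord_recr/=; exact: selfdualD.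
Qed.

Lemma continuous_affine_comp f (a b : R) : continuous f ->
  continuous (fun x => f (a * x + b)).
Proof.
move=> cf x; apply: continuous_comp; last exact: cf.
by apply: cvgD; [apply: cvgMr; exact: cvg_id|exact: cvg_cst].
Qed.

Lemma continuous_shift f (b : R) : continuous f -> continuous (fun x => f (x + b)).
Proof.
move=> cf; have := @continuous_affine_comp f 1 b cf.
by under eq_fun do rewrite mul1r.
Qed.

Lemma continuous_dilate f (a : R) : continuous f -> continuous (fun x => f (a * x)).
Proof.
move=> cf; have := @continuous_affine_comp f a 0 cf.
by under eq_fun do rewrite addr0.
Qed.

Lemma selfdual_dilate f (l : R) : 0 < l -> selfdual f ->
  selfdual (fun x => f (l * x) + l^-1 * f (l^-1 * x)).
Proof.
move=> l0 [cf lf ff]; have l0' : 0 < l^-1 by rewrite invr_gt0.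
have lf1 := L1_dilate l0 lf; have lf2 := L1_dilate l0' lf.
split.
- move=> x; apply: cvgD; first exact: continuous_dilate.
  by apply: cvgMr; exact: continuous_dilate.
- by apply: L1D => //; exact: L1Z.
- rewrite FT_reD//; last exact: L1Z.
  rewrite FT_reZ//; apply/funext => x.
  rewrite !FT_re_dilate// ff invrK addrC mulrA mulVf ?gt_eqF// mul1r; ring.
Qed.

Lemma selfdual_translate f (a : R) : selfdual f ->
  selfdual (fun x => (f (x + a) + f (x - a)) / 2 + f x * cos (2 * pi * x * a)).
Proof.
move=> sf; have fe := selfdual_even sf; case: sf => cf lf ff.
have lp := L1_shift a lf; have lm := L1_shift (- a) lf.
have lc := L1_cos a lf.
have E1 : (fun x => (f (x + a) + f (x - a)) / 2) =
    (fun x => 2^-1 * (f (x + a) + f (x - a))) by apply/funext => x; rewrite mulrC.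
have ls : L1 (fun x => (f (x + a) + f (x - a)) / 2).
  by rewrite E1; apply: L1Z; exact: L1D.
split.
- move=> x; apply: cvgD.
    by apply: cvgMl; apply: cvgD; exact: continuous_shift.
  apply: cvgM; first exact: cf.
  apply: continuous_comp; last exact: continuous_cos.
  by apply: cvgMl; apply: cvgMr; exact: cvg_id.
- exact: L1D.
- apply/funext => xi; rewrite FT_reD// FT_re_mulcos// ff E1 FT_reZ; last exact: L1D.
  rewrite FT_reD// !FT_re_shift// ff FT_im_even// !mulr0 !subr0 addrC; congr (_ + _).
  rewrite mulrN mulNr cosN (_ : 2 * pi * a * xi = 2 * pi * xi * a); last by ring.
  by move: (cos _) => c; lra.
Qed.

(** A second difference of step [s] in frequency multiplies [u] by [2 * cos (2 * pi * t * s) - 2],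
    which is at most 1/2 in size on the support. Where two of the three terms vanish, the third is
    the transform of this smaller function [v] at [x + s]. The transform of [v] vanishes beyond
    [y + s], so the step can be repeated, and each round gains a factor 1/2. *)
Lemma compact_support_step u (A s y : R) (n : nat) : L1 u ->
  (forall t, A <= `|t| -> u t = 0) ->
  (forall t, `|t| < A -> `|2 * cos (2 * pi * t * s) - 2| <= 2^-1) -> 0 <= s ->
  (forall x, y <= x -> FT_re u x = 0) ->
  forall x, y - s <= x -> `|FT_re u x| <= 2^-1 ^+ n * Int (fun t => `|u t|).
Proof.
elim: n u y => [|n IH] u y lu uA sA s0 u0 x xy.
  by rewrite expr0 mul1r FT_re_bound.
pose v t := 2 * (u t * cos (2 * pi * t * s)) - 2 * u t.
have lc := L1_cos s lu.
have lv : L1 v by apply: L1B; exact: L1Z.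
have E z : FT_re v z = FT_re u (z + s) + FT_re u (z - s) - 2 * FT_re u z.
  rewrite /v FT_reD; [|exact: L1Z|exact/L1N/L1Z].
  rewrite FT_reZ// FT_re_mulcos//.
  have -> : (fun t => - (2 * u t)) = (fun t => -2 * u t) by apply/funext => t; rewrite mulNr.
  by rewrite FT_reZ//; field.
have -> : FT_re u x = FT_re v (x + s).
  rewrite E addrK (u0 (x + s + s)) ?(u0 (x + s)); first by ring.
  - by lra.
  - by lra.
have bv t : `|v t| <= 2^-1 * `|u t|.
  have -> : v t = (2 * cos (2 * pi * t * s) - 2) * u t by rewrite /v; ring.
  rewrite normrM; have [tA|At] := ltP `|t| A; first by rewrite ler_wpM2r// sA.
  by rewrite uA// normr0 !mulr0.
apply: le_trans (IH v (y + s) lv _ sA s0 _ (x + s) _) _.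
- by move=> t At; apply/eqP; rewrite -normr_eq0 eq_le normr_ge0 (le_trans (bv t))// uA// normr0 mulr0.
- move=> z yz; rewrite E (u0 (z + s)) ?(u0 (z - s)) ?(u0 z); [by ring|by lra..].
- by lra.
rewrite exprSr -mulrA ler_wpM2l ?exprn_ge0// -IntZ; last exact: L1_norm.
by apply: Int_le => //; [exact: L1_norm|exact/L1Z/L1_norm].
Qed.

(** An elementary replacement for analyticity. Letting [n] grow in [compact_support_step] pushes the
    zero set of the transform to the left by [s]; as [s] depends only on [A], repeating this
    exhausts the line. *)
Lemma compact_support_FT_re u (A B : R) : L1 u ->
  (forall t, A <= `|t| -> u t = 0) -> (forall x, B <= x -> FT_re u x = 0) ->
  forall x, FT_re u x = 0.
Proof.
move=> lu uA uB.
have [s s0 sA] : exists2 s : R, 0 < s &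
    forall t, `|t| < A -> `|2 * cos (2 * pi * t * s) - 2| <= 2^-1.
  have h40 : 0 < (4^-1 : R) by [].
  have /cvgrPdist_lt/(_ _ h40) [d /= d0 Hd] := @continuous_cos R 0.
  have A0 : 0 < 2 * pi * (1 + `|A|) :> R.
    by rewrite !mulr_gt0 ?pi_gt0// ltr_wpDr.
  exists (d / (2 * pi * (1 + `|A|))); first by rewrite divr_gt0.
  move=> t tA.
  have : `|cos 0 - cos (2 * pi * t * (d / (2 * pi * (1 + `|A|))))| < 4^-1.
    apply: Hd => /=; rewrite sub0r normrN.
    have p0 : 0 < 2 * pi :> R by rewrite mulr_gt0 ?pi_gt0.
    rewrite normrM (normrM (2 * pi)) (gtr0_norm p0) (gtr0_norm (divr_gt0 d0 A0)).
    rewrite mulrA ltr_pdivrMr// mulrC ltr_pM2l// ltr_pM2l//.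
    by apply: lt_le_trans tA _; rewrite (le_trans (ler_norm A))// lerDr.
  rewrite cos0; move: (cos _) => c; rewrite ltr_norml ler_norml; lra.
have step y : (forall x, y <= x -> FT_re u x = 0) -> forall x, y - s <= x -> FT_re u x = 0.
  move=> hy x xy; apply/eqP; rewrite -normr_eq0 eq_le normr_ge0 andbT.
  have c : 2^-1 ^+ n * Int (fun t => `|u t|) @[n --> \oo] --> (0 : R).
    rewrite -[X in _ --> X](mul0r (Int (fun t => `|u t|))); apply: cvgMl.
    by apply: cvg_expr; rewrite ger0_norm// invf_lt1// ltr1n.
  by apply: (cvgr_to_ge c); apply: nearW => n;
    exact: (compact_support_step n lu uA sA (ltW s0) hy).
have all n : forall x, B - n%:R * s <= x -> FT_re u x = 0.
  elim: n => [|n IH] x; first by rewrite mul0r subr0 => /uB.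
  move=> h; apply: (step (B - n%:R * s)) => //.
  by rewrite -natr1 mulrDl mul1r opprD addrA in h.
move=> x.
have [n hn] : exists n : nat, (B - x) / s < n%:R.
  exists (Num.bound `|(B - x) / s|).
  by apply: le_lt_trans (ler_norm _) _; apply: archi_boundP.
apply: (all n); move: hn; rewrite ltr_pdivrMr// => /ltW; lra.
Qed.

End SelfDual.

(** * The triangle function, the Fejer kernel and a self-dual function of exact quadratic decay *)

Section Fejer.
Context {R : realType}.

Definition triangle (x : R) : R := Num.max 0 (1 - `|x|).

Lemma triangle_ge0 x : 0 <= triangle x.
Proof. by rewrite /triangle le_max lexx. Qed.

Lemma triangle_supp x : 1 <= `|x| -> triangle x = 0.
Proof. by move=> h; rewrite /triangle max_l// subr_le0. Qed.

Lemma triangle_in x : `|x| <= 1 -> triangle x = 1 - `|x|.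
Proof. by move=> h; rewrite /triangle max_r// subr_ge0. Qed.

Lemma triangle0 : triangle 0 = 1.
Proof. by rewrite triangle_in normr0 ?subr0. Qed.

Lemma triangle_le1 x : triangle x <= 1.
Proof. by rewrite /triangle ge_max ler01/= gerBl. Qed.

Lemma triangleN x : triangle (- x) = triangle x.
Proof. by rewrite /triangle normrN. Qed.

Lemma triangle_continuous : continuous triangle.
Proof.
move=> x; apply: (@continuous_max _ _ (cst 0) (fun x => 1 - `|x|)); first exact: cvg_cst.
by apply: cvgB; [exact: cvg_cst|apply: cvg_norm; exact: cvg_id].
Qed.

Lemma triangle_le_indic x : triangle x <= \1_(`[-1, 1]%classic) x.
Proof.
rewrite indicE; have [h|h] := leP `|x| 1.
  by rewrite mem_set ?triangle_le1//= in_itv/= -ler_norml.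
by rewrite triangle_supp; [exact: ler0n|exact: ltW].
Qed.

Lemma L1_triangle : L1 triangle.
Proof.
apply: (L1_dominated _ (L1_indic_itv (-1) 1)).
  exact: (continuous_mfun triangle_continuous).
by move=> x; rewrite ger0_norm ?triangle_ge0// triangle_le_indic.
Qed.

(** This is [(sin (pi x) / (pi x)) ^ 2]; as a transform it needs no separate value at 0. *)
Definition fejer := FT_re triangle.

Lemma fejerE (x : R) : x != 0 ->
  fejer x = (1 - cos (2 * pi * x)) / (2 * pi ^+ 2 * x ^+ 2).
Proof.
move=> x0; pose f t := triangle t * cos (2 * pi * t * x).
have lf : L1 f by exact: (L1_cos x L1_triangle).
have mul_indic (a b : R) : L1 (fun t => f t * \1_(`[a, b]%classic) t).
  apply: (L1M_bounded lf (L1_measurable (L1_indic_itv a b)) (C := 1)) => t.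
  by rewrite indicE; case: (_ \in _); rewrite ?normr1 ?normr0.
have -> : fejer x = \int[@leb R]_(t in `[-1, 0]) f t + \int[@leb R]_(t in `[0, 1]) f t.
  (* The integral over [[0, 0]], which is 0, removes the double count of the point 0, so that the
     restrictions add up to [f] at every point. *)
  have -> : \int[@leb R]_(t in `[0, 1]) f t =
     \int[@leb R]_(t in `[0, 1]) f t - \int[@leb R]_(t in `[0, 0]) f t.
    by rewrite set_itv1 Rintegral_set1 subr0.
  rewrite !Int_restrict// -IntB// -IntD//; last exact: L1B.
  apply: eq_Int => t; rewrite -/(f t) !indicE.
  have [t1|t1] := leP `|t| 1; last first.
    have -> : f t = 0 by rewrite /f triangle_supp ?mul0r// ltW.
    by rewrite !mul0r; ring.
  have [t0|t0|->] := ltgtP t 0.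
  - rewrite mem_set/=; last by rewrite in_itv/=; move: t1; rewrite ler_norml; lra.
    rewrite memNset/=; last by rewrite in_itv/=; lra.
    by rewrite memNset/=; [ring|rewrite in_itv/=; lra].
  - rewrite memNset/=; last by rewrite in_itv/=; lra.
    rewrite mem_set/=; last by rewrite in_itv/=; move: t1; rewrite ler_norml; lra.
    by rewrite memNset/=; [ring|rewrite in_itv/=; lra].
  - by rewrite !mem_set/=; [ring|rewrite in_itv/=; lra..].
have a0 : 2 * pi * x != 0 by rewrite mulf_neq0// mulf_neq0// gt_eqF ?pi_gt0.
have pn : (pi : R) != 0 by rewrite gt_eqF ?pi_gt0.
have cc (g : R -> R) : (forall t : R, derivable g t 1) -> continuous g.
  by move=> dg t; apply: differentiable_continuous; apply/derivable1_diffP.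
have -> : \int[@leb R]_(t in `[-1, 0]) f t = (1 - cos (2 * pi * x)) / (2 * pi * x) ^+ 2.
  rewrite (@eq_Rintegral _ _ _ (@leb R) _ (fun t => (1 + t) * cos (2 * pi * t * x))); last first.
    move=> t; rewrite inE/= in_itv/= => /andP[t1 t0]; rewrite /f triangle_in ?ler0_norm//; last lra.
    by rewrite opprK.
  have dF (t : R) : is_derive t (1 : R) (fun t => (1 + t) * sin (2 * pi * t * x) / (2 * pi * x) +
      cos (2 * pi * t * x) / (2 * pi * x) ^+ 2) ((1 + t) * cos (2 * pi * t * x)).
    apply: is_derive_eq; rewrite /GRing.scale/=.
    by move: (@pi R) pn => p pn; field; rewrite x0 pn.
  rewrite (continuous_FTC _ _ dF); first last.
  - by apply: cc => t; apply: ex_derive.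
  - by lra.
  rewrite ?mulr0 ?mul0r ?sin0 ?cos0 ?mulrN ?mulNr ?mulr1 ?cosN.
  by move: (@pi R) pn => p pn; field; rewrite x0 pn.
have -> : \int[@leb R]_(t in `[0, 1]) f t = (1 - cos (2 * pi * x)) / (2 * pi * x) ^+ 2.
  rewrite (@eq_Rintegral _ _ _ (@leb R) _ (fun t => (1 - t) * cos (2 * pi * t * x))); last first.
    move=> t; rewrite inE/= in_itv/= => /andP[t1 t0]; rewrite /f triangle_in ?ger0_norm//.
  have dF (t : R) : is_derive t (1 : R) (fun t => (1 - t) * sin (2 * pi * t * x) / (2 * pi * x) -
      cos (2 * pi * t * x) / (2 * pi * x) ^+ 2) ((1 - t) * cos (2 * pi * t * x)).
    apply: is_derive_eq; rewrite /GRing.scale/=.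
    by move: (@pi R) pn => p pn; field; rewrite x0 pn.
  rewrite (continuous_FTC _ _ dF); first last.
  - by apply: cc => t; apply: ex_derive.
  - by lra.
  rewrite ?mulr0 ?mul0r ?sin0 ?cos0 ?mulrN ?mulNr ?mulr1 ?cosN.
  by move: (@pi R) pn => p pn; field; rewrite x0 pn.
by move: (@pi R) pn => p pn; field; rewrite x0 pn.
Qed.

Lemma fejer_le2 (x : R) : fejer x <= 2.
Proof.
apply: le_trans (ler_norm _) _; apply: le_trans (FT_re_bound x L1_triangle) _.
have -> : 2 = Int (\1_(`[-1, 1]%classic) : R -> R) by rewrite Int_indic_itv; lra.
apply: Int_le; [exact/L1_norm/L1_triangle|exact: L1_indic_itv|] => y.
by rewrite ger0_norm ?triangle_ge0// triangle_le_indic.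
Qed.

Lemma fejer_sin (x : R) : x != 0 -> fejer x = sin (pi * x) ^+ 2 / (pi ^+ 2 * x ^+ 2).
Proof.
move=> x0; rewrite fejerE// (_ : 2 * pi * x = (pi * x) *+ 2); last by rewrite mulr2n; ring.
rewrite cos_mulr2n cos2sin2.
have pn : (pi : R) != 0 by rewrite gt_eqF ?pi_gt0.
by move: (@pi R) pn => p pn; field; rewrite x0 pn.
Qed.

(** Weakening [x] to [1 + |x|] in the denominator gives a bound that also makes sense at 0 and is
    stable under small shifts. *)
Lemma fejer_ge (x : R) : sin (pi * x) ^+ 2 / (pi ^+ 2 * (1 + `|x|) ^+ 2) <= fejer x.
Proof.
have [->|x0] := eqVneq x 0.
  rewrite mulr0 sin0 expr0n mul0r /fejer FT_re0.
  by apply: Int_ge0 => y; exact: triangle_ge0.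
rewrite fejer_sin// ler_wpM2l ?sqr_ge0//.
have p : 0 < pi ^+ 2 :> R by rewrite exprn_gt0 ?pi_gt0.
have x2 : 0 < x ^+ 2 by rewrite exprn_even_gt0.
have h1 : x ^+ 2 <= (1 + `|x|) ^+ 2.
  rewrite -(real_normK (num_real x)) ler_sqr ?nnegrE ?addr_ge0// lerDr//.
rewrite lef_pV2 ?posrE; first by rewrite ler_pM2l.
- by apply: mulr_gt0 => //; exact: lt_le_trans h1.
- exact: mulr_gt0.
Qed.

Lemma fejer_ge0 (x : R) : 0 <= fejer x.
Proof.
apply: le_trans (fejer_ge x); apply: divr_ge0; first exact: sqr_ge0.
by apply: mulr_ge0; exact: sqr_ge0.
Qed.

Lemma fejer_le_inv (x : R) : fejer x <= 3 / (1 + x ^+ 2).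
Proof.
rewrite ler_pdivlMr ?one_sqr_gt0//.
have [->|x0] := eqVneq x 0.
  by rewrite expr0n addr0 mulr1; have := fejer_le2 0; lra.
rewrite mulrDr mulr1.
(* The constant 3 is the sum of [fejer x <= 2] and this bound. *)
suff : fejer x * x ^+ 2 <= 1 by have := fejer_le2 x; lra.
rewrite fejer_sin//.
have p1 : 1 <= pi ^+ 2 :> R.
  by rewrite expr_ge1 ?pi_ge0//; apply: le_trans (pi_ge2 R); rewrite ler1n.
have -> : sin (pi * x) ^+ 2 / (pi ^+ 2 * x ^+ 2) * x ^+ 2 = sin (pi * x) ^+ 2 / pi ^+ 2.
  have pn : (pi : R) != 0 by rewrite gt_eqF ?pi_gt0.
  by move: (@pi R) pn {p1} => p pn; field; rewrite x0 pn.
rewrite ler_pdivrMr ?exprn_gt0 ?pi_gt0// mul1r (le_trans _ p1)//.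
Qed.

Lemma fejer_continuous : continuous fejer.
Proof. exact: FT_re_continuous L1_triangle. Qed.

Lemma L1_fejer : L1 fejer.
Proof.
exact: (L1_le_inv_one_sqr (continuous_mfun fejer_continuous) fejer_ge0 fejer_le_inv).
Qed.

Lemma Int_fejer : Int fejer = 1.
Proof.
rewrite (Int_FT_re L1_triangle) ?triangle0//; [exact: triangle_continuous|exact: L1_fejer].
Qed.

Lemma FT_re_fejer : FT_re fejer = triangle.
Proof.
apply: FT_re_inversion; [exact: triangle_continuous|exact: L1_triangle|exact: L1_fejer|].
by move=> xi; apply: FT_im_even; [exact: L1_triangle|exact: triangleN].
Qed.

Lemma selfdual_fejer : selfdual (fun x => fejer x + triangle x).
Proof.
split.
- by move=> x; apply: cvgD; [exact: fejer_continuous|exact: triangle_continuous].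
- by apply: L1D; [exact: L1_fejer|exact: L1_triangle].
- rewrite FT_reD; [|exact: L1_fejer|exact: L1_triangle].
  by rewrite FT_re_fejer; apply/funext => x; rewrite addrC.
Qed.

(* [sin^2 + cos^2 = 1] makes the two translates of the Fejer kernel add up to a
   function without zeros, of the exact decay rate of the kernel. *)
Lemma selfdual_quadratic_decay : exists P : R -> R, selfdual P /\
  exists2 c, 0 < c & forall x, c / (1 + x ^+ 2) <= P x.
Proof.
pose S x := fejer x + triangle x.
pose T x := (S (x + 2^-1) + S (x - 2^-1)) / 2 + S x * cos (2 * pi * x * 2^-1).
exists (fun x => 2 * S x + T x); split.
  apply: selfdualD; first exact/selfdualZ/selfdual_fejer.
  exact/selfdual_translate/selfdual_fejer.
have pp : 0 < pi ^+ 2 :> R by rewrite exprn_gt0 ?pi_gt0.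
exists (16 * pi ^+ 2)^-1; first by rewrite invr_gt0 mulr_gt0.
move=> x.
have S0 y : 0 <= S y by rewrite addr_ge0 ?fejer_ge0 ?triangle_ge0.
have Sf y : fejer y <= S y by rewrite lerDl triangle_ge0.
have h1 : S x * (1 + cos (2 * pi * x * 2^-1)) >= 0.
  by rewrite mulr_ge0//; have := @cos_geN1 R (2 * pi * x * 2^-1); lra.
have h2 := S0 (x - 2^-1).
have h3 := le_trans (fejer_ge x) (Sf x).
have h4 := le_trans (fejer_ge (x + 2^-1)) (Sf (x + 2^-1)).
apply: (@le_trans _ _ (S x + S (x + 2^-1) / 2)); last first.
  by rewrite /T; move: (cos _) h1 => c h1; lra.
have E : sin (pi * (x + 2^-1)) ^+ 2 = 1 - sin (pi * x) ^+ 2.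
  by rewrite mulrDr sinDpihalf cos2sin2.
rewrite E in h4.
have n1 : 0 <= sin (pi * x) ^+ 2 <= 1.
  by rewrite sqr_ge0/= -subr_ge0 -cos2sin2 sqr_ge0.
(* Since [(2 + |x|) ^ 2 <= 8 * (1 + x ^ 2)], this one denominator serves both [x] and [x + 1/2]. The
   weight 1/2 of the translate then gives the 16 in the final constant. *)
set q := 8 * pi ^+ 2 * (1 + x ^+ 2).
have q0 : 0 < q by rewrite /q mulr_gt0 ?one_sqr_gt0// mulr_gt0.
have b (y : R) : `|y| <= `|x| + 1 -> pi ^+ 2 * (1 + `|y|) ^+ 2 <= q.
  move=> hy; rewrite /q (_ : 8 * pi ^+ 2 * (1 + x ^+ 2) = pi ^+ 2 * (8 * (1 + x ^+ 2))); last by ring.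
  rewrite ler_pM2l//.
  have : (1 + `|y|) ^+ 2 <= (2 + `|x|) ^+ 2.
    by rewrite ler_sqr ?nnegrE ?addr_ge0//; lra.
  have := sqr_ge0 (`|x| - 1); have <- := real_normK (num_real x).
  move: `|x| => z; nra.
have P (y : R) : 0 < pi ^+ 2 * (1 + `|y|) ^+ 2.
  by rewrite mulr_gt0// exprn_gt0// ltr_wpDr.
have k1 : sin (pi * x) ^+ 2 / q <= S x.
  apply: le_trans h3; rewrite ler_wpM2l ?sqr_ge0// lef_pV2 ?posrE ?P//.
  by apply: b; lra.
have k2 : (1 - sin (pi * x) ^+ 2) / q <= S (x + 2^-1).
  have n2 : 0 <= 1 - sin (pi * x) ^+ 2 by rewrite subr_ge0; case/andP: n1.
  apply: le_trans h4; rewrite ler_wpM2l//.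
  rewrite lef_pV2 ?posrE ?P//; apply: b.
  by apply: le_trans (ler_normD _ _) _; rewrite lerD2l ger0_norm; lra.
have -> : (16 * pi ^+ 2)^-1 / (1 + x ^+ 2) = 2^-1 * q^-1.
  rewrite /q -invfM -invfM; congr (_^-1); ring.
have q1 : 0 <= sin (pi * x) ^+ 2 / q by rewrite divr_ge0 ?sqr_ge0 ?(ltW q0).
move: k1 k2 q1; rewrite mulrBl mul1r.
by move: (sin (pi * x) ^+ 2 / q) (q^-1) (S x) (S (x + 2^-1)) => z w a1 a2; lra.
Qed.

End Fejer.

(** * From weak to strict inequalities by dilations and translations *)

Section Perturbation.
Context {R : realType}.
Implicit Types (f g : R -> R).

(** Otherwise [f] would vanish outside a bounded set, and so would its transform, which is [f]
    again. *)
Lemma selfdual_far_positive f (r X : R) : selfdual f -> (exists x, f x != 0) ->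
  (forall x, r <= `|x| -> 0 <= f x) -> exists2 x0, X <= x0 & 0 < f x0.
Proof.
move=> sf [x1 fx1] f0; apply: contrapT => h.
have z x : Num.max X (Num.max 0 r) <= `|x| -> f x = 0.
  rewrite !ge_max => /and3P[Xx _ rx].
  apply/eqP; rewrite eq_le f0// andbT leNgt; apply/negP => fx.
  by apply: h; exists `|x| => //; rewrite selfdual_norm.
have [cf lf ff] := sf.
have := @compact_support_FT_re R f _ (Num.max X (Num.max 0 r)) lf z.
rewrite ff => /(_ _ x1) h1; move/eqP: fx1; apply; apply: h1 => x hx.
by apply: z; apply: le_trans hx (ler_norm x).
Qed.

(** A single positive value [f x0] is smeared out: as [l] runs from 1 to [r' / r], the points
    [x0 / l] sweep an interval whose length grows with [x0]. A sum over a fine grid of such [l] is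
    positive on all of it, and no dilation moves the sign radius beyond [r']. *)
Lemma selfdual_positive_interval f (r r' U L : R) : selfdual f -> (exists x, f x != 0) ->
  0 < r -> r < r' -> 0 < L -> f 0 <= 0 -> (forall x, r <= `|x| -> 0 <= f x) ->
  exists g u, [/\ selfdual g, g 0 <= 0, (forall x, r' <= `|x| -> 0 <= g x), U <= u &
    forall x, u <= x <= u + L -> 0 < g x].
Proof.
move=> sf fn0 r0 rr' L0 f00 fr.
pose d := r' / r - 1.
have d0 : 0 < d by rewrite subr_gt0 ltr_pdivlMr// mul1r.
(* So far out that [u = x0 / (1 + d)] exceeds [r'], [U] and [L / d]; the last makes the stretch from
   [u] to [x0], of length [d * u], at least [L]. *)
have [x0 hx0 fx0] := selfdual_far_positive ((1 + d) * (r' + `|U| + L / d)) sf fn0 fr.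
have d1 : 0 < 1 + d by rewrite ltr_wpDl.
have Ld : 0 < L / d by rewrite divr_gt0.
pose u := x0 / (1 + d).
have uE : x0 = (1 + d) * u by rewrite /u mulrCA divff ?mulr1 ?gt_eqF.
have r'0 : 0 < r' by exact: lt_trans rr'.
have hu : r' + `|U| + L / d <= u by rewrite /u ler_pdivlMr// mulrC.
have u0 : 0 < u by apply: lt_le_trans hu; rewrite ltr_wpDl// addr_ge0// ltW.
have r'u : r' <= u by apply: le_trans hu; rewrite -addrA lerDl addr_ge0// ltW.
have uL : u + L <= x0.
  have : L / d <= u by apply: le_trans hu; rewrite lerDr addr_ge0// ltW.
  by rewrite ler_pdivrMr// uE; lra.
have x00 : 0 < x0 by rewrite uE mulr_gt0.
have [cf lf ff] := sf.
have /cvgrPdist_lt/(_ _ fx0) [e /= e0 He] := cf x0.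
(* Adjacent dilations move a point below [x0] by at most [d / n * x0], which has to stay below the
   radius [e] on which [f] is known to be positive. *)
have [n hn] : exists n : nat, d * x0 / e < n%:R.
  exists (Num.bound `|d * x0 / e|).
  by apply: le_lt_trans (ler_norm _) _; apply: archi_boundP.
have n0 : 0 < n%:R :> R by apply: le_lt_trans hn; rewrite divr_ge0 ?mulr_ge0 ?ltW.
pose l (i : nat) : R := 1 + i%:R * (d / n%:R).
have dn0 : 0 < d / n%:R by rewrite divr_gt0.
have l1 i : 1 <= l i by rewrite lerDl mulr_ge0// ltW.
have l0 i : 0 < l i by apply: lt_le_trans (l1 i).
pose D i x := f (l i * x) + (l i)^-1 * f ((l i)^-1 * x).
have sD i : selfdual (D i) by exact: selfdual_dilate.
have D1 (i : 'I_n.+1) x : r' <= `|x| ->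
    0 <= f (l i * x) /\ 0 <= (l i)^-1 * f ((l i)^-1 * x).
  move=> xr; split.
    apply: fr; rewrite normrM (gtr0_norm (l0 i)).
    apply: le_trans (ltW rr') _; apply: le_trans xr _.
    by rewrite ler_peMl.
  apply: mulr_ge0; first by rewrite invr_ge0 ltW.
  apply: fr; rewrite normrM gtr0_norm ?invr_gt0// mulrC ler_pdivlMr//.
  apply: le_trans xr; rewrite (_ : r' = r * (1 + d)).
    rewrite ler_wpM2l ?(ltW r0)// lerD2l mulrC -mulrA ler_piMr ?(ltW d0)//.
    by rewrite mulrC ler_pdivrMr// mul1r ler_nat -ltnS.
  by rewrite /d addrCA subrr addr0 mulrCA divff ?mulr1 ?gt_eqF.
have D0 (i : 'I_n.+1) x : r' <= `|x| -> 0 <= D i x.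
  by move=> /(D1 i)[? ?]; exact: addr_ge0.
exists (fun x => \sum_(i < n.+1) D i x), u; split.
- exact: selfdual_sum.
- apply: sumr_le0 => i _; rewrite /D !mulr0.
  rewrite (_ : _ + _ = (1 + (l i)^-1) * f 0); last by ring.
  apply: mulr_ge0_le0 => //.
  by rewrite addr_ge0// invr_ge0 ltW.
- by move=> x xr; apply: sumr_ge0 => i _; exact: D0.
- apply: le_trans hu; apply: le_trans (ler_norm U) _.
  by rewrite -addrA addrCA lerDl addr_ge0// ltW.
move=> x /andP[ux xL].
have x1 : 0 < x by exact: lt_le_trans ux.
have xx0 : x <= x0 by exact: le_trans uL.
(* The real grid index whose dilation takes [x] exactly to [x0]; its integer part gives a summand
   that is positive at [x]. *)
pose t := (x0 / x - 1) * (n%:R / d).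
have t0 : 0 <= t.
  rewrite mulr_ge0 ?divr_ge0 ?(ltW d0)// subr_ge0 ler_pdivlMr// mul1r//.
have tn : t <= n%:R.
  rewrite /t mulrA ler_pdivrMr// mulrC ler_wpM2l ?(ltW n0)//.
  by rewrite lerBlDl ler_pdivrMr// uE ler_wpM2l ?(ltW d1).
have /andP[it ti] := truncn_itv t0.
set i := Num.truncn t in it ti.
have iE : (i < n.+1)%N by rewrite ltnS -(ler_nat R) (le_trans it).
have rx : r' <= `|x| by rewrite (gtr0_norm x1) (le_trans r'u).
rewrite (bigD1 (Ordinal iE))//= ltr_pwDl//; last by apply: sumr_ge0 => j _; exact: D0.
have xt : x0 = (1 + t * (d / n%:R)) * x.
  have -> : t * (d / n%:R) = x0 / x - 1.
    by rewrite /t -mulrA (_ : n%:R / d * (d / n%:R) = 1) ?mulr1//; field; rewrite !gt_eqF.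
  by rewrite addrCA subrr addr0 -mulrA mulVf ?mulr1 ?gt_eqF.
apply: ltr_pwDl.
  have : `|f x0 - f (l i * x)| < f x0.
    apply: He => /=; rewrite {1}xt /l -mulrBl (_ : _ - _ = (t - i%:R) * (d / n%:R)); last by ring.
    rewrite ger0_norm; last by rewrite mulr_ge0 ?(ltW x1)// mulr_ge0 ?(ltW dn0)// subr_ge0.
    apply: (@le_lt_trans _ _ (d / n%:R * x0)).
      apply: ler_pM => //; first by rewrite mulr_ge0 ?(ltW dn0)// subr_ge0.
      - exact: ltW.
      - rewrite ler_piMl ?(ltW dn0)//; move: ti; rewrite -natr1; lra.
    by move: hn; rewrite ltr_pdivrMr// => hn; rewrite mulrAC ltr_pdivrMr// (mulrC e).
  by rewrite ltr_norml; lra.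
by have [] := D1 (Ordinal iE) x rx.
Qed.

Lemma sin_le0_pi (x : R) : pi <= x <= 2 * pi -> sin x <= 0.
Proof.
move=> /andP[h1 h2]; rewrite -[x](subrK pi) sinDpi oppr_le0.
by apply: sin_ge0_pi; lra.
Qed.

(** Doubling the angle gives [cos x ^ 2 >= 1/2]. The rational 6/10 lies below the root of 1/2, and
    above 1/2, so that twice it exceeds 1. *)
Lemma cos_ge_piquarter (x : R) : 0 <= x <= pi / 4 -> 6 / 10 <= cos x.
Proof.
move=> /andP[x0 x4].
have p0 := pi_gt0 R.
have c0 : 0 <= cos x by apply: cos_ge0_pihalf; lra.
have c2 : 0 <= cos (x *+ 2) by apply: cos_ge0_pihalf; rewrite (mulr2n x); lra.
move: c2; rewrite cos_mulr2n => h; rewrite leNgt; apply/negP => hc.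
have : cos x ^+ 2 < (6 / 10) ^+ 2 by rewrite ltr_sqr ?nnegrE.
by rewrite (mulr2n (cos x ^+ 2)) in h; lra.
Qed.

(* Maximizing sin (pi (t - p) / L) / g t over [p, p + L] yields a point at which
   [g] is at least as concave as the sine, in the sense of symmetric means. *)
Lemma symmetric_mean_point g (p L : R) : 0 < L -> continuous g ->
  (forall x, p <= x <= p + L -> 0 < g x) ->
  exists2 a, p <= a <= p + L &
    forall x, 0 <= x <= L / 4 ->
      (forall y, p - L / 4 <= y <= p + L + L / 4 -> 0 <= g y) ->
      12 / 10 * g a <= g (a + x) + g (a - x).
Proof.
move=> L0 cg gp.
pose s t := sin (pi * ((t - p) / L)).
have pi0 := pi_gt0 R.
have cs : continuous s.
  move=> t; apply: continuous_comp; last exact: continuous_sin.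
  apply: cvgMr; apply: cvgMl; apply: cvgB; [exact: cvg_id|exact: cvg_cst].
have [||a ain amax] := @EVT_max R (fun t => s t / g t) p (p + L) _ _.
- by rewrite lerDl ltW.
- apply: continuous_in_subspaceT => t; rewrite inE/= in_itv/= => tp.
  apply: cvgM; first exact: cs.
  apply: cvgV; last exact: cg.
  by rewrite gt_eqF// gp.
have {}ain : p <= a <= p + L by move: ain; rewrite in_itv.
have ga := gp _ ain.
have sa : 0 < s a.
  have m : p <= p + L / 2 <= p + L by apply/andP; split; lra.
  have : 0 < s a / g a.
    apply: lt_le_trans (amax (p + L / 2) _); last by rewrite in_itv.
    apply: divr_gt0; last exact: gp.
    rewrite /s (_ : (p + L / 2 - p) / L = 2^-1); last by field; rewrite gt_eqF.
    by rewrite sin_pihalf.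
  by rewrite pmulr_lgt0 ?invr_gt0.
exists a => // x /andP[x0 xL] g0.
(* Maximality of the quotient gives this on [[p, p + L]]. In the margins of width [L / 4] the sine
   is nonpositive and [g] is nonnegative, so it persists there. *)
have key y : p - L / 4 <= y <= p + L + L / 4 -> s y * g a <= g y * s a.
  move=> /andP[y1 y2].
  have [yp|py] := ltP y p.
    apply: (@le_trans _ _ 0); last by rewrite mulr_ge0 ?(ltW sa)// g0// y1.
    apply: mulr_le0_ge0; last exact: ltW.
    rewrite /s -[pi * _]opprK sinN oppr_le0; apply: sin_ge0_pi.
    have -> : - (pi * ((y - p) / L)) = pi * ((p - y) / L) by ring.
    apply/andP; split.
      by rewrite mulr_ge0 ?(ltW pi0)// divr_ge0 ?(ltW L0)//; lra.
    by rewrite ler_piMr ?(ltW pi0)// ler_pdivrMr//; lra.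
  have [yq|qy] := leP y (p + L); last first.
    apply: (@le_trans _ _ 0); last by rewrite mulr_ge0 ?(ltW sa)// g0// y1.
    apply: mulr_le0_ge0; last exact: ltW.
    apply: sin_le0_pi; apply/andP; split.
      by rewrite ler_peMr ?(ltW pi0)// ler_pdivlMr//; lra.
    by rewrite mulrC ler_wpM2r ?(ltW pi0)// ler_pdivrMr//; lra.
  have yin : p <= y <= p + L by rewrite py yq.
  have := amax y; rewrite in_itv/= => /(_ yin).
  by rewrite ler_pdivrMr ?gp// mulrAC ler_pdivlMr// mulrC [s a * _]mulrC.
have /andP[a1 a2] := ain.
have k1 : s (a + x) * g a <= g (a + x) * s a by apply: key; lra.
have k2 : s (a - x) * g a <= g (a - x) * s a by apply: key; lra.
have E : s (a + x) + s (a - x) = 2 * s a * cos (pi * (x / L)).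
  rewrite /s (_ : pi * ((a + x - p) / L) = pi * ((a - p) / L) + pi * (x / L)); last by ring.
  rewrite (_ : pi * ((a - x - p) / L) = pi * ((a - p) / L) - pi * (x / L)); last by ring.
  by rewrite sinD sinB; ring.
have hc : 6 / 10 <= cos (pi * (x / L)).
  apply: cos_ge_piquarter; apply/andP; split.
    by rewrite mulr_ge0 ?(ltW pi0)// divr_ge0 ?(ltW L0).
  by rewrite ler_wpM2l ?(ltW pi0)// ler_pdivrMr//; lra.
rewrite -(ler_pM2r sa) (mulrDl (g (a + x))).
apply: le_trans (lerD k1 k2); rewrite -(mulrDl (s (a + x))) E.
have sg : 0 < s a * g a by rewrite mulr_gt0.
have : 6 / 10 * (s a * g a) <= cos (pi * (x / L)) * (s a * g a).
  by rewrite ler_wpM2r// ltW.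
by move: (cos _) => c; lra.
Qed.

(** The length [10 * r] leaves room for [a] in an interval of length [8 * r] and for positivity of
    [g] on [[a - r, a + r]]. With [8 * r], the symmetric mean estimate reaches distance [2 * r],
    which is as far as translation by [b <= r] can cause harm. *)
Lemma selfdual_negative_origin g (r u : R) : selfdual g -> 0 < r -> g 0 <= 0 ->
  (forall x, r <= `|x| -> 0 <= g x) -> 2 * r <= u ->
  (forall x, u <= x <= u + 10 * r -> 0 < g x) ->
  exists F, [/\ selfdual F, F 0 < 0 & forall x, r <= `|x| -> 0 <= F x].
Proof.
move=> sg r0 g00 gr u2 gpos.
have [cg lg gg] := sg; have ge := selfdual_even sg.
have L0 : 0 < 8 * r by lra.
have [a /andP[a1 a2] amean] : exists2 a, u + r <= a <= u + r + 8 * r &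
    forall x, 0 <= x <= 2 * r -> 12 / 10 * g a <= g (a + x) + g (a - x).
  have [|a ain h] := symmetric_mean_point (p := u + r) L0 cg.
    by move=> x hx; apply: gpos; lra.
  exists a => // x hx; apply: h; first by lra.
  by move=> y hy; apply: gr; rewrite ger0_norm; lra.
have ga : 0 < g a by apply: gpos; lra.
have [b bin bmin] : exists2 b, b \in `[0, r]%R & forall t, t \in `[0, r]%R -> g b <= g t.
  apply: EVT_min; first exact: ltW.
  by apply: continuous_in_subspaceT => t _; exact: cg.
have {}/andP[b0 br] : 0 <= b <= r by move: bin; rewrite in_itv.
(* Self-duality makes [g 0] the integral of [g]; a nonnegative continuous [g] with integral at most
   0 vanishes, contrary to [g a > 0]. *)
have gb : g b < 0.
  rewrite ltNge; apply/negP => gb0.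
  have gge0 x : 0 <= g x.
    have [/gr//|xr] := leP r `|x|.
    rewrite -(selfdual_norm sg) (le_trans gb0)// bmin// in_itv/= normr_ge0 ltW//.
  have i0 : Int g = 0.
    by rewrite -FT_re0 gg; apply/eqP; rewrite eq_le g00 gge0.
  by have := Int_eq0 cg gge0 lg i0 a => h; rewrite h ltxx in ga.
pose m := - g b.
have m0 : 0 < m by rewrite oppr_gt0.
have gm x : - m <= g x.
  rewrite opprK; have [/gr h|xr] := leP r `|x|; first exact: le_trans (ltW gb) h.
  by rewrite -(selfdual_norm sg x) bmin// in_itv/= normr_ge0 ltW.
have [c cin cmin] : exists2 c, c \in `[a - r, a + r]%R &
    forall t, t \in `[a - r, a + r]%R -> g c <= g t.
  apply: EVT_min; first by lra.
  by apply: continuous_in_subspaceT => t _; exact: cg.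
have gc : 0 < g c by apply: gpos; move: cin; rewrite in_itv/=; lra.
(* 11/10 lies between 1 and the 12/10 of the symmetric mean: above 1, [g a - eta * m] is negative at
   0; below 12/10, the two translations together stay nonnegative away from 0. *)
pose eta := 11 / 10 * g a / m.
have etam : eta * m = 11 / 10 * g a by rewrite /eta -mulrA mulVf ?mulr1 ?gt_eqF.
have eta0 : 0 < eta by rewrite divr_gt0// mulr_gt0//; lra.
(* Near [a] both translates may take negative values, down to [- m]; there [g x >= g c], and
   [K * g x] outweighs them. *)
pose K := (1 + eta) * m / g c.
have KE : K * g c = (1 + eta) * m by rewrite /K -mulrA mulVf ?mulr1 ?gt_eqF.
have K0 : 0 <= K by rewrite divr_ge0 ?(ltW gc)// mulr_ge0 ?(ltW m0)//; lra.
pose T (t : R) x := (g (x + t) + g (x - t)) / 2 + g x * cos (2 * pi * x * t).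
(* The coefficients 1 and [eta] absorb the cosine terms, which are at least [- g x] and
   [- eta * g x]. At 0 the extra multiples of [g 0] are nonpositive and do no harm. *)
pose F x := (1 + eta + K) * g x + (T a x + eta * T b x).
have sF : selfdual F.
  apply: selfdualD; first exact: selfdualZ.
  by apply: selfdualD; [exact: selfdual_translate|apply: selfdualZ; exact: selfdual_translate].
exists F; split => //.
- have T0 t : T t 0 = g t + g 0.
    by rewrite /T add0r sub0r ge mulr0 mul0r cos0; lra.
  have gbE : g b = - m by rewrite /m opprK.
  rewrite /F !T0 gbE (mulrDr eta) mulrN etam.
  have : (1 + eta + K + 1 + eta) * g 0 <= 0 by apply: mulr_ge0_le0 => //; lra.
  by move: (g 0) (g a) ga => z w w0; lra.
move=> x; rewrite -(selfdual_norm sF); move: `|x| => {}x rx.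
have gx : 0 <= g x by apply: gr; rewrite ger0_norm; lra.
have gxa : 0 <= g (x + a) by apply: gr; rewrite ger0_norm; lra.
have gxb : 0 <= g (x + b) by apply: gr; rewrite ger0_norm; lra.
have c1 : 0 <= g x * (1 + cos (2 * pi * x * a)).
  by rewrite mulr_ge0//; have := @cos_geN1 R (2 * pi * x * a); lra.
have c2 : 0 <= eta * (g x * (1 + cos (2 * pi * x * b))).
  by rewrite mulr_ge0 ?(ltW eta0)// mulr_ge0//; have := @cos_geN1 R (2 * pi * x * b); lra.
suff : 0 <= K * g x + (g (x + a) + g (x - a)) / 2 + eta * ((g (x + b) + g (x - b)) / 2).
  rewrite /F /T; move: c1 c2.
  move: (cos (2 * pi * x * a)) (cos (2 * pi * x * b)) => d1 d2 c1 c2; lra.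
have Kg : 0 <= K * g x by exact: mulr_ge0.
have eb : 0 <= eta * g (x + b) by rewrite mulr_ge0 ?(ltW eta0).
have em : - (eta * m) <= eta * g (x - b) by rewrite -mulrN ler_wpM2l ?(ltW eta0).
have gma := gm (x - a).
(* Three cases: [x] near [a], where [K] pays; [x - b >= r], where no term is negative; and
   [x < b + r <= 2 * r], where the symmetric mean at [a] pays. *)
have [xa|xa] := leP `|x - a| r.
  have : K * g c <= K * g x.
    apply: ler_wpM2l => //; apply: cmin; rewrite in_itv/=.
    by move: xa; rewrite ler_norml; lra.
  by rewrite KE; lra.
have gxma : 0 <= g (x - a) by apply: gr; exact: ltW.
have [xb|xb] := leP r (x - b).
  have : 0 <= eta * g (x - b).
    by rewrite mulr_ge0 ?(ltW eta0)//; apply: gr; rewrite ger0_norm; lra.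
  by lra.
have := amean x; rewrite (addrC a) -[a - x]opprB ge => /(_ _).
have hx : 0 <= x <= 2 * r by lra.
by move=> /(_ hx); rewrite etam in em; lra.
Qed.

Lemma selfdual_strict f (r r' : R) : selfdual f -> (exists x, f x != 0) ->
  0 < r -> r < r' -> f 0 <= 0 -> (forall x, r <= `|x| -> 0 <= f x) ->
  exists G c, [/\ selfdual G, G 0 < 0, 0 < c &
    forall x, r' <= `|x| -> c / (1 + x ^+ 2) <= G x].
Proof.
move=> sf fn0 r0 rr' f00 fr.
have r'0 : 0 < r' by exact: lt_trans rr'.
have L0 : 0 < 10 * r' by lra.
have [g [u [sg g00 gr' hu gpos]]] := selfdual_positive_interval (2 * r') sf fn0 r0 rr' L0 f00 fr.
have [F [sF F0 Fr]] := selfdual_negative_origin sg r'0 g00 gr' hu gpos.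
have [P [sP [c c0 Pc]]] := @selfdual_quadratic_decay R.
have P0 : 0 < P 0 by apply: lt_le_trans (Pc 0); rewrite divr_gt0 ?one_sqr_gt0.
(* Adding [eta * P] uses up half of the margin and leaves the value [F 0 / 2] at 0. *)
pose eta := - F 0 / 2 / P 0.
have eta0 : 0 < eta by rewrite !divr_gt0// oppr_gt0.
exists (fun x => F x + eta * P x), (eta * c); split.
- by apply: selfdualD => //; exact: selfdualZ.
- by rewrite /eta -mulrA mulVf ?gt_eqF// mulr1; lra.
- exact: mulr_gt0.
- move=> x hx; rewrite -mulrA.
  have := Fr x hx; have : eta * (c / (1 + x ^+ 2)) <= eta * P x.
    by rewrite ler_wpM2l ?(ltW eta0).
  lra.
Qed.

End Perturbation.

(** * Triangle cutoff and averages against the Fejer kernel *)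

Section Bandlimiting.
Context {R : realType}.
Implicit Types (G B : R -> R).

Lemma FT_re_triangle_mul G (k xi : R) : selfdual G -> 0 < k ->
  FT_re (fun x => triangle (k^-1 * x) * G x) xi =
  Int (fun t => G t * ((k * fejer (k * (t + xi)) + k * fejer (k * (t - xi))) / 2)).
Proof.
move=> [cG lG GG] k0.
have k0' : 0 < k^-1 by rewrite invr_gt0.
have lu : L1 (fun x : R => triangle (k^-1 * x)) by apply: L1_dilate => //; exact: L1_triangle.
rewrite -{1}GG FT_re_mul//.
have E y : FT_re (fun x => triangle (k^-1 * x)) y = k * fejer (k * y).
  by rewrite FT_re_dilate ?invrK//; exact: L1_triangle.
by apply: eq_Int => t; rewrite !E.
Qed.

Lemma L1_FT_re_triangle_mul G (k : R) : selfdual G -> 0 < k ->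
  L1 (FT_re (fun x => triangle (k^-1 * x) * G x)).
Proof.
move=> [cG lG GG] k0.
have k0' : 0 < k^-1 by rewrite invr_gt0.
have lu : L1 (fun x : R => triangle (k^-1 * x)) by apply: L1_dilate => //; exact: L1_triangle.
rewrite -{1}GG; apply: L1_FT_re_mul => //.
have -> : FT_re (fun x => triangle (k^-1 * x)) = (fun y => k * fejer (k * y)).
  by apply/funext => y; rewrite FT_re_dilate ?invrK//; exact: L1_triangle.
by apply: L1Z; apply: L1_dilate => //; exact: L1_fejer.
Qed.

Lemma continuous_dilate_shift (f : R -> R) (k a : R) : continuous f ->
  continuous (fun t : R => f (k * (t + a))).
Proof.
move=> cf; rewrite (_ : (fun t => _) = (fun t => f (k * t + k * a))).
  exact: continuous_affine_comp.
by apply/funext => t; rewrite mulrDr.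
Qed.

Lemma L1_mul_fejer G (k a : R) : L1 G -> 0 < k ->
  L1 (fun t => G t * (k * fejer (k * (t + a)))).
Proof.
move=> lG k0; apply: (@L1M_bounded _ _ _ (k * 2)) => //.
  apply: continuous_mfun => t; apply: cvgMr.
  by apply: continuous_dilate_shift; exact: fejer_continuous.
move=> t; rewrite ger0_norm ?mulr_ge0 ?(ltW k0) ?fejer_ge0//.
by rewrite ler_wpM2l ?(ltW k0)// fejer_le2.
Qed.

Lemma fejer_scaled_le (k y s : R) : 0 < k -> 0 < s -> s <= `|y| ->
  k * fejer (k * y) <= 3 / (k * s ^+ 2).
Proof.
move=> k0 s0 sy.
apply: (@le_trans _ _ (k * (3 / (1 + (k * y) ^+ 2)))).
  by rewrite ler_wpM2l ?(ltW k0)// fejer_le_inv.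
have s2 : s ^+ 2 <= y ^+ 2.
  by rewrite -(real_normK (num_real y)) ler_sqr ?nnegrE ?(ltW s0).
have ss : 0 < s ^+ 2 by exact: exprn_gt0.
have kk : 0 < k ^+ 2 by exact: exprn_gt0.
rewrite mulrA ler_pdivrMr ?one_sqr_gt0//.
rewrite mulrAC ler_pdivlMr ?mulr_gt0// exprMn.
have : k ^+ 2 * s ^+ 2 <= k ^+ 2 * y ^+ 2 by rewrite ler_wpM2l ?(ltW kk).
lra.
Qed.

(** Compares the decay of [G] near [xi] with that of the leak from [[-r, r]]. As [xi - r >= 2 * d],
    both 1 and [r + d] are bounded by multiples of [xi - r], and [xi + d] is
    [(xi - r) + (r + d)]. *)
Lemma one_sqr_le_sqr_sub (r d xi : R) : 0 < r -> 0 < d -> r + 2 * d <= xi ->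
  1 + (xi + d) ^+ 2 <= (1 / (4 * d ^+ 2) + (1 + (r + d) / (2 * d)) ^+ 2) * (xi - r) ^+ 2.
Proof.
move=> r0 d0 h; rewrite mulrDl -exprMn; apply: lerD.
  rewrite mulrAC mul1r ler_pdivlMr ?mulr_gt0 ?exprn_gt0// mul1r.
  have : (2 * d) ^+ 2 <= (xi - r) ^+ 2 by rewrite ler_sqr ?nnegrE; lra.
  by rewrite exprMn; lra.
have h2 : 0 < (r + d) / (2 * d) by rewrite divr_gt0; lra.
have h3 : r + d <= (r + d) / (2 * d) * (xi - r).
  rewrite mulrAC ler_pdivlMr; last lra.
  by rewrite ler_wpM2l; lra.
rewrite ler_sqr ?nnegrE; first by rewrite mulrDl mul1r; lra.
  by lra.
by rewrite mulr_ge0; lra.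
Qed.

(** The window of radius [d] about [xi] contributes at least [A / 4], and [[-r, r]] takes away at
    most [N * (2 * r)]. Both decay like the inverse square of [xi], so a single [k] serves all
    [xi]. *)
Lemma fejer_mean_positive G (c r d k M xi : R) : selfdual G -> 0 < c -> 0 < r -> 0 < d ->
  0 < k -> (forall x, r <= `|x| -> c / (1 + x ^+ 2) <= G x) -> (forall x, - M <= G x) -> 0 <= M ->
  2^-1 <= Int (fun x => \1_(`[-d, d]%classic) x * (k * fejer (k * x))) ->
  24 * M * r * (1 / (4 * d ^+ 2) + (1 + (r + d) / (2 * d)) ^+ 2) / c <= k ->
  r + 2 * d <= xi ->
  0 <= FT_re (fun x => triangle (k^-1 * x) * G x) xi.
Proof.
move=> sG c0 r0 d0 k0 Gc GM M0 hk1 hk2 hxi.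
have [cG lG GG] := sG.
rewrite FT_re_triangle_mul//.
set C := _ + _ in hk2.
pose s := xi - r.
have s0 : 0 < s by rewrite /s; lra.
pose A := c / (1 + (xi + d) ^+ 2).
have A0 : 0 < A by rewrite divr_gt0// one_sqr_gt0.
pose N := 3 * M / (k * s ^+ 2).
have ks : 0 < k * s ^+ 2 by rewrite mulr_gt0// exprn_gt0.
have N0 : 0 <= N by rewrite divr_ge0 ?(ltW ks)// mulr_ge0.
(* The left side is [6 * M * r / (k * s ^+ 2)]; the factor 4 from the right turns 6 into the 24 of
   the hypothesis on [k]. *)
have key : N * (2 * r) <= A / 4.
  have hC := one_sqr_le_sqr_sub r0 d0 hxi; rewrite -/C -/s in hC.
  have x1 := one_sqr_gt0 (xi + d).
  have s2 : 0 < s ^+ 2 by exact: exprn_gt0.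
  have M6 : 0 <= 6 * M * r by rewrite !mulr_ge0// ltW.
  rewrite ler_pdivrMr// in hk2.
  have e1 := ler_wpM2l M6 hC; have e2 := ler_wpM2r (ltW s2) hk2.
  rewrite /A /N; move: (1 + (xi + d) ^+ 2) (s ^+ 2) (C) x1 s2 e1 e2 ks => X S C' x1 s2 e1 e2 ks.
  rewrite (_ : 3 * M / (k * S) * (2 * r) = 6 * M * r / (k * S)); last by ring.
  rewrite (_ : c / X / 4 = c / (4 * X)); last by field; rewrite gt_eqF.
  rewrite ler_pdivrMr// (mulrAC c) ler_pdivlMr ?mulr_gt0//; lra.
clear hk2.
pose I x : R := \1_(`[-d, d]%classic) (x - xi) * (k * fejer (k * (x - xi))).
have f0 y : 0 <= k * fejer (k * y) by rewrite mulr_ge0 ?(ltW k0) ?fejer_ge0.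
(* In the window only the kernel centred at [xi] is kept, hence the 1/2. On [[-r, r]] both kernels
   are at most [3 / (k * s ^+ 2)], and elsewhere the integrand is nonnegative. *)
have pw t : A / 2 * I t - N * \1_(`[-r, r]%classic) t <=
    G t * ((k * fejer (k * (t + xi)) + k * fejer (k * (t - xi))) / 2).
  move: {hk1 key GG lG cG sG} t => t.
  rewrite /I !indicE.
  have p1 := f0 (t + xi); have p2 := f0 (t - xi).
  have [tI|tI] := boolP (t - xi \in `[-d, d]%classic).
    move: tI; rewrite inE/= in_itv/= => tI.
    rewrite memNset/=; last by rewrite in_itv/=; lra.
    rewrite mulr0 subr0 mul1r.
    have t2 : t ^+ 2 <= (xi + d) ^+ 2 by rewrite ler_sqr ?nnegrE; lra.
    have GA : A <= G t.
      apply: le_trans (Gc t _); last by rewrite ger0_norm; lra.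
      by rewrite ler_wpM2l ?(ltW c0)// lef_pV2 ?posrE ?one_sqr_gt0// lerD2l.
    have : A * (k * fejer (k * (t - xi))) <= G t * (k * fejer (k * (t - xi))).
      by rewrite ler_wpM2r.
    have : 0 <= G t * (k * fejer (k * (t + xi))) by rewrite mulr_ge0// (le_trans (ltW A0)).
    move: (k * fejer (k * (t - xi))) (k * fejer (k * (t + xi))) => u v; lra.
  rewrite mul0r mulr0 sub0r.
  have [tr|tr] := boolP (t \in `[-r, r]%classic).
    move: tr; rewrite inE/= in_itv/= => tr; rewrite mulr1.
    have q1 : k * fejer (k * (t + xi)) <= 3 / (k * s ^+ 2).
      by apply: fejer_scaled_le => //; rewrite ger0_norm /s; lra.
    have q2 : k * fejer (k * (t - xi)) <= 3 / (k * s ^+ 2).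
      by apply: fejer_scaled_le => //; rewrite ler0_norm /s; lra.
    set v := (_ + _) / 2; have v0 : 0 <= v by rewrite /v; lra.
    apply: (@le_trans _ _ (- M * v)); last by rewrite ler_wpM2r.
    rewrite mulNr lerN2 /N (_ : 3 * M / _ = M * (3 / (k * s ^+ 2))); last by ring.
    by rewrite ler_wpM2l// /v; lra.
  rewrite mulr0 oppr0 mulr_ge0//; last by lra.
  apply: le_trans (Gc t _); first by rewrite divr_ge0 ?(ltW c0) ?(ltW (one_sqr_gt0 _)).
  move: tr; apply: contraNT; rewrite -ltNge => tr.
  by rewrite mem_set//= in_itv/= -ler_norml ltW.
have lI0 : L1 (fun x : R => \1_(`[-d, d]%classic) x * (k * fejer (k * x))).
  have := L1_mul_fejer 0 (L1_indic_itv (-d) d) k0.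
  by under eq_fun do rewrite addr0.
have lI : L1 I by exact: (L1_shift (- xi) lI0).
have lJ := L1_indic_itv (- r) r.
have iI : 2^-1 <= Int I by rewrite (Int_shift (- xi) lI0).
have l1 := L1_mul_fejer xi lG k0; have l2 := L1_mul_fejer (- xi) lG k0.
have lR : L1 (fun t => G t * ((k * fejer (k * (t + xi)) + k * fejer (k * (t - xi))) / 2)).
  have := L1Z 2^-1 (L1D l1 l2); congr L1; apply/funext => t; ring.
apply: (@le_trans _ _ (Int (fun t => A / 2 * I t - N * \1_(`[-r, r]%classic) t))); last first.
  by apply: Int_le => //; apply: L1B; exact: L1Z.
rewrite IntB; [|exact: L1Z|exact: L1Z].
rewrite IntZ// IntZ// Int_indic_itv; last by rewrite (le_trans _ (ltW r0))// oppr_le0 ltW.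
move: (Int I) iI {hk1} => Z iI.
have : A / 2 * 2^-1 <= A / 2 * Z by rewrite ler_wpM2l// divr_ge0// ltW.
by lra.
Qed.

Lemma selfdual_triangle_cutoff G (c r r' : R) : selfdual G -> G 0 < 0 -> 0 < c -> 0 < r -> r < r' ->
  (forall x, r <= `|x| -> c / (1 + x ^+ 2) <= G x) ->
  exists k, [/\ r' < k,
    FT_re (fun x => triangle (k^-1 * x) * G x) 0 < 0 &
    forall xi, r' <= `|xi| -> 0 <= FT_re (fun x => triangle (k^-1 * x) * G x) xi].
Proof.
move=> sG G0 c0 r0 rr' Gc.
have [cG lG GG] := sG.
pose d := (r' - r) / 2.
have d0 : 0 < d by rewrite /d; lra.
pose M := Int (fun x => `|G x|).
have M0 : 0 <= M by exact: Int_ge0.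
have GM x : - M <= G x.
  by have := selfdual_bound sG x; rewrite ler_norml => /andP[].
have mf := continuous_mfun (@fejer_continuous R).
have e10 : 0 < - G 0 / 2 by lra.
have [k1 [k10 hk1]] := approximate_identity mf (@fejer_ge0 R) (@fejer_le_inv R) (@Int_fejer R)
  lG (cG 0) e10.
have e20 : 0 < 2^-1 :> R by [].
(* Tested on this indicator, the approximate identity says that the scaled kernel has mass at least
   1/2 in [[-d, d]]. *)
have cI : {for 0, continuous (\1_(`[-d, d]%classic) : R -> R)}.
  apply: cvg_near_cst; near=> x.
  rewrite !indicE !mem_set//=; first by rewrite in_itv/=; lra.
  rewrite in_itv/= -ler_norml.
  near: x; exists d => //= y /=; rewrite sub0r normrN; exact: ltW.
have [k2 [k20 hk2]] := approximate_identity mf (@fejer_ge0 R) (@fejer_le_inv R) (@Int_fejer R)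
  (L1_indic_itv (-d) d) cI e20.
pose k3 := 24 * M * r * (1 / (4 * d ^+ 2) + (1 + (r + d) / (2 * d)) ^+ 2) / c.
(* In this order: the value at 0 stays negative, half of the kernel mass lies in the window, the
   leak is dominated, and the triangle is positive up to [r']. *)
pose k := Num.max (Num.max k1 k2) (Num.max k3 (r' + 1)).
have [kk1 kk2 kk3 kk4] : [/\ k1 <= k, k2 <= k, k3 <= k & r' + 1 <= k].
  by split; rewrite /k !le_max lexx ?orbT.
have k0 : 0 < k by exact: lt_le_trans kk1.
exists k; split; first by lra.
- rewrite FT_re_triangle_mul//.
  have -> : Int (fun t => G t * ((k * fejer (k * (t + 0)) + k * fejer (k * (t - 0))) / 2)) =
      Int (fun t => G t * (k * fejer (k * t))).
    by apply: eq_Int => t; rewrite subr0 addr0; congr (_ * _); lra.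
  by have := hk1 k kk1; rewrite ler_norml; lra.
move=> xi hxi; rewrite -FT_re_norm.
apply: (fejer_mean_positive sG c0 r0 d0 k0 Gc GM M0) => //; last by rewrite /d; lra.
have := hk2 k kk2; rewrite ler_norml indicE mem_set/=; first by lra.
by rewrite in_itv/=; lra.
Unshelve. all: by end_near. Qed.

Lemma inAplus_FT_re B (r : R) : continuous B -> L1 B -> (forall x, B (- x) = B x) ->
  L1 (FT_re B) -> B 0 <= 0 -> FT_re B 0 <= 0 ->
  (forall x, r <= `|x| -> 0 <= B x) -> (forall x, r <= `|x| -> 0 <= FT_re B x) ->
  FT_re (FT_re B) = B /\ inAplus (FT_re B).
Proof.
move=> cB lB eB lFB B0 FB0 Br FBr.
have im0 xi : FT_im B xi = 0 by exact: FT_im_even.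
have inv := FT_re_inversion cB lB lFB im0.
split => //; split.
- exact: FT_re_continuous.
- by rewrite inv.
- by move=> xi; apply: FT_im_even => // x; exact: FT_reN.
- by rewrite inv; split => //; exists r.
- by rewrite inv; split => //; exists r.
Qed.

End Bandlimiting.

(** * Schwartz estimates for Gaussians times bandlimited functions *)

Section GaussianSums.
Context {R : realType}.
Implicit Types (f g w : R -> R).

Definition L1_csupp w := L1 w /\ exists A : R, forall t, A <= `|t| -> w t = 0.

Lemma L1_csupp_mulX w : L1_csupp w -> L1_csupp (fun t => t * w t).
Proof.
move=> [lw [A wA]]; split; last by exists A => t /wA ->; rewrite mulr0.
apply: (@L1_dominated _ _ (fun t => `|A| * `|w t|)).
- by apply: measurable_funM; [exact: measurable_id|exact: L1_measurable].
- exact/L1Z/L1_norm.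
- move=> t; rewrite normrM; have [/wA->|tA] := leP A `|t|; first by rewrite normr0 !mulr0.
  by rewrite ler_wpM2r// (le_trans (ltW tA))// ler_norm.
Qed.

Lemma FT_im_bound w (xi : R) : L1 w -> `|FT_im w xi| <= Int (fun x => `|w x|).
Proof.
move=> lw; rewrite normrN; apply: le_trans (Int_norm (L1_sin xi lw)) _.
apply: Int_le; [exact/L1_norm/L1_sin|exact: L1_norm|] => x.
by rewrite normrM ler_piMr// norm_sin_le1.
Qed.

(* Closed under differentiation and rapidly decreasing: this class contains the
   product of a bandlimited function with a Gaussian. *)
Inductive gaussian_sum (c : R) : (R -> R) -> Prop :=
| GaussianSumRe j w : L1_csupp w -> gaussian_sum c (fun x => x ^+ j * FT_re w x * gau (c * x))
| GaussianSumIm j w : L1_csupp w -> gaussian_sum c (fun x => x ^+ j * FT_im w x * gau (c * x))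
| GaussianSumD f g : gaussian_sum c f -> gaussian_sum c g -> gaussian_sum c (fun x => f x + g x)
| GaussianSumZ a f : gaussian_sum c f -> gaussian_sum c (fun x => a * f x).

(** The product rule arranged so that each summand is again monomial times function times Gaussian.
    At [j = 0] the truncated exponent [j.-1] is harmless, as its coefficient is 0. *)
Lemma is_derive_monomial_gau (c : R) (j : nat) (W W' : R -> R) (x : R) :
  is_derive x (1 : R) W (W' x) ->
  is_derive x (1 : R) (fun x => x ^+ j * W x * gau (c * x))
   (j%:R * (x ^+ j.-1 * W x * gau (c * x)) + (x ^+ j * W' x * gau (c * x) +
    - (2 * pi * c ^+ 2) * (x ^+ j.+1 * W x * gau (c * x)))).
Proof.
move=> dW.
have dg : is_derive x (1 : R) (fun x => gau (c * x)) (- (2 * pi * c ^+ 2) * (x * gau (c * x))).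
  have h := is_derive_gau (c * x).
  have := @is_derive1_comp _ gau (fun x => c * x) x _ _ h.
  move=> h2; apply: is_derive_eq; rewrite /GRing.scale/=; ring.
have dX : is_derive x (1 : R) (fun x : R => x ^+ j) (j%:R * x ^+ j.-1).
  elim: j => [|j IH].
    by rewrite mul0r; under eq_fun do rewrite expr0; exact: is_derive_cst.
  under eq_fun do rewrite exprS.
  apply: is_derive_eq; rewrite /GRing.scale/=.
  by case: j {IH} => [|j]; rewrite /= ?exprS -?natr1; ring.
have prod (X : R -> R) (dXx : R) : is_derive x (1 : R) X dXx ->
    is_derive x (1 : R) (fun x => X x * W x * gau (c * x))
    (dXx * W x * gau (c * x) + X x * W' x * gau (c * x) +
      X x * W x * (- (2 * pi * c ^+ 2) * (x * gau (c * x)))).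
  by move=> hX; apply: is_derive_eq; rewrite /GRing.scale/=; ring.
have := prod _ _ dX.
congr is_derive; rewrite (exprS x j).
by move: (x ^+ j) (x ^+ j.-1) => u v; ring.
Qed.

Lemma gaussian_sum_derive (c : R) f : gaussian_sum c f ->
  exists2 f', gaussian_sum c f' & forall x : R, is_derive x (1 : R) f (f' x).
Proof.
elim => [j w cw|j w cw|{}f g _ [f' gf df] _ [g' gg dg]|a {}f _ [f' gf df]].
- have [lw _] := cw; have cw' := L1_csupp_mulX cw; have [lw' _] := cw'.
  exists (fun x => j%:R * (x ^+ j.-1 * FT_re w x * gau (c * x)) +
    (2 * pi * (x ^+ j * FT_im (fun t => t * w t) x * gau (c * x)) +
    - (2 * pi * c ^+ 2) * (x ^+ j.+1 * FT_re w x * gau (c * x)))).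
    apply: GaussianSumD; first by apply: GaussianSumZ; exact: GaussianSumRe.
    by apply: GaussianSumD; apply: GaussianSumZ; [exact: GaussianSumIm|exact: GaussianSumRe].
  move=> x; have := is_derive_monomial_gau c j
    (W' := fun x => 2 * pi * FT_im (fun t => t * w t) x) (is_derive_FT_re x lw lw').
  by move=> h; apply: is_derive_eq; ring.
- have [lw _] := cw; have cw' := L1_csupp_mulX cw; have [lw' _] := cw'.
  exists (fun x => j%:R * (x ^+ j.-1 * FT_im w x * gau (c * x)) +
    (- (2 * pi) * (x ^+ j * FT_re (fun t => t * w t) x * gau (c * x)) +
    - (2 * pi * c ^+ 2) * (x ^+ j.+1 * FT_im w x * gau (c * x)))).
    apply: GaussianSumD; first by apply: GaussianSumZ; exact: GaussianSumIm.
    by apply: GaussianSumD; apply: GaussianSumZ; [exact: GaussianSumRe|exact: GaussianSumIm].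
  move=> x; have := is_derive_monomial_gau c j
    (W' := fun x => - (2 * pi * FT_re (fun t => t * w t) x)) (is_derive_FT_im x lw lw').
  by move=> h; apply: is_derive_eq; ring.
- exists (fun x => f' x + g' x); first exact: GaussianSumD.
  by move=> x; exact: is_deriveD.
- exists (fun x => a * f' x); first exact: GaussianSumZ.
  by move=> x; exact: is_deriveZ.
Qed.

Lemma gaussian_sum_derive1n (c : R) f (n : nat) : gaussian_sum c f -> gaussian_sum c (derive1n n f).
Proof.
move=> gf; elim: n => [//|n IH]; rewrite derive1nS.
have [f' gf' df'] := gaussian_sum_derive IH.
suff -> : derive1 (derive1n n f) = f' by [].
by apply/funext => x; rewrite derive1E; have [_ ->] := df' x.
Qed.

(** With [c' = c / sqrt 2] the Gaussian is the square of [gau (c' * x)]: one factor absorbs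
    [|x| ^ n] by induction, the other the remaining [|x|]. *)
Lemma monomial_gau_bounded (n : nat) (c : R) : 0 < c ->
  exists C : R, forall x : R, `|x| ^+ n * gau (c * x) <= C.
Proof.
elim: n c => [|n IH] c c0.
  by exists 1 => x; rewrite expr0 mul1r gau_le1.
pose c' := c / Num.sqrt 2.
have s0 : 0 < Num.sqrt 2 :> R by rewrite sqrtr_gt0.
have c'0 : 0 < c' by rewrite divr_gt0.
have [C hC] := IH c' c'0.
have C0 : 0 <= C by apply: le_trans (hC 0); rewrite mulr_ge0 ?exprn_ge0// ltW ?gau_gt0.
exists (C / c') => x.
have E : gau (c * x) = gau (c' * x) * gau (c' * x).
  rewrite /gau -expRD /c'; congr expR.
  by rewrite !exprMn exprVn sqr_sqrtr//; field.
rewrite exprSr E mulrACA; apply: ler_pM.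
- by rewrite mulr_ge0 ?exprn_ge0// ltW ?gau_gt0.
- by rewrite mulr_ge0// ltW ?gau_gt0.
- exact: hC.
rewrite -div1r ler_pdivlMr//.
have := norm_mul_gau_le (c' * x).
rewrite normrM (ger0_norm (ltW (gau_gt0 _))) normrM (gtr0_norm c'0) => h.
have h1 := le_trans h (gau_le1 _).
lra.
Qed.

Lemma gaussian_sum_bounded (c : R) f (k : nat) : 0 < c -> gaussian_sum c f ->
  exists C : R, forall x : R, `|x| ^+ k * `|f x| <= C.
Proof.
move=> c0.
have gen j (W : R -> R) (b : R) : (forall x, `|W x| <= b) ->
    exists C : R, forall x : R, `|x| ^+ k * `|x ^+ j * W x * gau (c * x)| <= C.
  move=> Wb; have [C hC] := monomial_gau_bounded (k + j) c0.
  exists (C * b) => x; rewrite !normrM normrX (ger0_norm (ltW (gau_gt0 _))).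
  rewrite (_ : _ * _ = (`|x| ^+ (k + j) * gau (c * x)) * `|W x|); last by rewrite exprD; ring.
  apply: ler_pM => //.
  by rewrite mulr_ge0 ?exprn_ge0// ltW ?gau_gt0.
elim => [j w [lw _]|j w [lw _]|{}f g _ [C1 h1] _ [C2 h2]|a {}f _ [C h]].
- by apply: gen => x; exact: FT_re_bound.
- by apply: gen => x; exact: FT_im_bound.
- exists (C1 + C2) => x; apply: le_trans (lerD (h1 x) (h2 x)).
  by rewrite -mulrDr ler_wpM2l ?exprn_ge0// ler_normD.
- exists (`|a| * C) => x; rewrite normrM mulrCA ler_wpM2l//.
Qed.

Lemma gaussian_sum_schwartz (c : R) f : 0 < c -> gaussian_sum c f -> schwartz f.
Proof.
move=> c0 gf; split=> [n x|k n].
  have [f' _ df] := gaussian_sum_derive (gaussian_sum_derive1n n gf).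
  by have [] := df x.
exact: (gaussian_sum_bounded k c0 (gaussian_sum_derive1n n gf)).
Qed.

Lemma schwartz_gau_mul_FT_re (c : R) w : 0 < c -> L1_csupp w ->
  schwartz (fun x => gau (c * x) * FT_re w x).
Proof.
move=> c0 cw; apply: (gaussian_sum_schwartz c0).
have := GaussianSumRe c 0 cw.
by under eq_fun do rewrite expr0 mul1r mulrC.
Qed.

End GaussianSums.

(** * Gaussian cutoff: from bandlimited to Schwartz competitors *)

Section GaussianCutoff.
Context {R : realType}.
Implicit Types (B : R -> R).

Lemma gau_le_norm (x y : R) : `|x| <= `|y| -> gau y <= gau x.
Proof.
move=> xy; rewrite ler_expR lerN2 ler_wpM2l ?pi_ge0//.
by rewrite -(real_normK (num_real x)) -(real_normK (num_real y)) ler_sqr ?nnegrE.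
Qed.

Lemma FT_re_gau_mul B (k xi : R) : L1 B -> 0 < k ->
  FT_re (fun x => gau (k^-1 * x) * FT_re B x) xi =
  Int (fun t => B t * ((k * gau (k * (t + xi)) + k * gau (k * (t - xi))) / 2)).
Proof.
move=> lB k0.
have lu : L1 (fun x : R => gau (k^-1 * x)) by apply: L1_dilate; [rewrite invr_gt0|exact: L1_gau].
rewrite FT_re_mul//.
by apply: eq_Int => t; rewrite !FT_re_gau_dilate.
Qed.

Lemma L1_mul_gau_shift B (k a : R) : L1 B -> 0 < k ->
  L1 (fun t => B t * (k * gau (k * (t + a)))).
Proof.
move=> lB k0; apply: (@L1M_bounded _ _ _ k) => //.
  apply: continuous_mfun => t; apply: cvgMr.
  by apply: continuous_dilate_shift; exact: gau_continuous.
move=> t; rewrite ger0_norm ?mulr_ge0 ?(ltW k0) ?(ltW (gau_gt0 _))//.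
by rewrite ler_piMr ?(ltW k0)// gau_le1.
Qed.

(** For [xi >= q], [U] bounds the kernel from below on [[p, q]] and [V] bounds it from above on
    [[-r, r]]. No lower bound of [B] at infinity is involved, as only the ratio of [V] to [U]
    counts. *)
Lemma gaussian_mean_positive B (r p q k b M xi : R) : L1 B -> 0 < r -> r < p -> p < q ->
  0 < k -> 0 < b -> 0 <= M -> q <= xi ->
  (forall x, r <= `|x| -> 0 <= B x) -> (forall x, p <= x <= q -> b <= B x) ->
  (forall x, - M <= B x) -> 2 * r * M * gau (k * (p - r)) <= b * (q - p) / 2 ->
  0 <= FT_re (fun x => gau (k^-1 * x) * FT_re B x) xi.
Proof.
move=> lB r0 rp pq k0 b0 M0 qxi Br Bb BM hk.
rewrite FT_re_gau_mul//.
pose U := k * gau (k * (xi - p)); pose V := k * gau (k * (xi - r)).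
have U0 : 0 <= U by rewrite mulr_ge0 ?(ltW k0)// ltW ?gau_gt0.
have V0 : 0 <= V by rewrite mulr_ge0 ?(ltW k0)// ltW ?gau_gt0.
(* From [(xi - r) ^ 2 >= (xi - p) ^ 2 + (p - r) ^ 2]. The factor does not depend on [xi], so one [k]
   works for all of them. *)
have VU : V <= U * gau (k * (p - r)).
  rewrite /V /U -mulrA ler_wpM2l ?(ltW k0)// /gau -expRD ler_expR.
  rewrite -opprD lerN2 -mulrDr ler_wpM2l ?pi_ge0// !exprMn -mulrDr.
  rewrite ler_wpM2l ?sqr_ge0//.
  have : 0 <= (xi - p) * (p - r) by rewrite mulr_ge0; lra.
  have -> : (xi - r) ^+ 2 = (xi - p) ^+ 2 + (p - r) ^+ 2 + 2 * ((xi - p) * (p - r)) by ring.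
  lra.
have l1 := L1_mul_gau_shift xi lB k0; have l2 := L1_mul_gau_shift (- xi) lB k0.
have lR : L1 (fun t => B t * ((k * gau (k * (t + xi)) + k * gau (k * (t - xi))) / 2)).
  have := L1Z 2^-1 (L1D l1 l2); congr L1; apply/funext => t; ring.
have g0 y : 0 <= k * gau (k * y) by rewrite mulr_ge0 ?(ltW k0)// ltW ?gau_gt0.
have lpq := L1_indic_itv p q; have lrr := L1_indic_itv (- r) r.
apply: (@le_trans _ _ (Int (fun t => b * U / 2 * \1_(`[p, q]%classic) t -
    M * V * \1_(`[-r, r]%classic) t))).
  rewrite IntB; [|exact: L1Z|exact: L1Z].
  rewrite IntZ// IntZ// !Int_indic_itv; [|lra|lra].
  have e1 := ler_wpM2l U0 hk.
  have e2 : 2 * r * M * V <= 2 * r * M * (U * gau (k * (p - r))).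
    by rewrite ler_wpM2l// !mulr_ge0// ltW.
  move: (gau _) e1 e2 => G e1 e2; lra.
clear hk.
apply: Int_le => //; first by apply: L1B; exact: L1Z.
move=> t; rewrite !indicE.
have p1 := g0 (t + xi); have p2 := g0 (t - xi).
have [tI|tI] := boolP (t \in `[p, q]%classic).
  move: tI; rewrite inE/= in_itv/= => tI.
  rewrite memNset/=; last by rewrite in_itv/=; lra.
  rewrite mulr0 subr0 mulr1.
  have UU : U <= k * gau (k * (t - xi)).
    rewrite ler_wpM2l ?(ltW k0)//; apply: gau_le_norm.
    rewrite !normrM ler_wpM2l// ler0_norm; last lra.
    by rewrite ger0_norm; lra.
  have e1 : b * U <= B t * (k * gau (k * (t - xi))).
    by apply: ler_pM => //; [exact: ltW|exact: Bb].
  have e2 : 0 <= B t * (k * gau (k * (t + xi))) by rewrite mulr_ge0// (le_trans (ltW b0))// Bb.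
  move: (k * gau (k * (t - xi))) (k * gau (k * (t + xi))) e1 e2 => u v e1 e2; lra.
rewrite mulr0 sub0r.
have [tr|tr] := boolP (t \in `[-r, r]%classic).
  move: tr; rewrite inE/= in_itv/= => tr; rewrite mulr1.
  have q1 : k * gau (k * (t + xi)) <= V.
    rewrite ler_wpM2l ?(ltW k0)//; apply: gau_le_norm.
    rewrite !normrM ler_wpM2l// ger0_norm; last lra.
    by rewrite ger0_norm; lra.
  have q2 : k * gau (k * (t - xi)) <= V.
    rewrite ler_wpM2l ?(ltW k0)//; apply: gau_le_norm.
    rewrite !normrM ler_wpM2l// ger0_norm; last lra.
    by rewrite ler0_norm; lra.
  set v := (_ + _) / 2; have v0 : 0 <= v by rewrite /v; lra.
  apply: (@le_trans _ _ (- M * v)); last by rewrite ler_wpM2r.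
  by rewrite mulNr lerN2 ler_wpM2l// /v; lra.
rewrite mulr0 oppr0 mulr_ge0//; last by lra.
apply: Br.
move: tr; apply: contraNT; rewrite -ltNge => tr.
by rewrite mem_set//= in_itv/= -ler_norml ltW.
Qed.

(** The competitor [h] is a wide Gaussian times [FT_re B]: it inherits the signs of [FT_re B], is
    smooth because [B] has compact support, and decays by the Gaussian. Positivity of [B] just
    outside [[-r, r]] controls the transform of [h]. *)
Lemma schwartz_of_bandlimited B (r r' : R) : continuous B -> L1_csupp B ->
  (forall x, B (- x) = B x) -> L1 (FT_re B) -> 0 < r -> r < r' ->
  B 0 < 0 -> FT_re B 0 < 0 ->
  (forall x, r <= `|x| -> 0 <= B x) -> (forall x, r < x <= r' -> 0 < B x) ->
  (forall x, r' <= `|x| -> 0 <= FT_re B x) ->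
  exists h, [/\ inAplus h, (exists x, h x != 0), schwartz h,
    (forall x, r' <= `|x| -> 0 <= h x) & (forall x, r' <= `|x| -> 0 <= FT_re h x)].
Proof.
move=> cB sB eB lFB r0 rr' B0 FB0 Br Bpos FBr'.
have [lB _] := sB.
have im0 xi : FT_im B xi = 0 by exact: FT_im_even.
have inv := FT_re_inversion cB lB lFB im0.
pose M := Int (fun x => `|FT_re B x|).
have M0 : 0 <= M by exact: Int_ge0.
have BM x : - M <= B x.
  by have := FT_re_bound x lFB; rewrite inv ler_norml => /andP[].
pose p := (r + r') / 2.
have rp : r < p by rewrite /p; lra.
have pr' : p < r' by rewrite /p; lra.
have [|| c cin cmin] := @EVT_min R B p r' _ _.
- exact: ltW.
- by apply: continuous_in_subspaceT => t _; exact: cB.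
have b0 : 0 < B c by apply: Bpos; move: cin; rewrite in_itv/=; lra.
have e0 : 0 < - B 0 / 2 by lra.
have mg := continuous_mfun (@gau_continuous R).
have [k0 [k00 hk0]] := approximate_identity mg (fun x => ltW (gau_gt0 x)) (@gau_le_quadratic R)
  (@Int_gau R) lB (cB 0) e0.
pose T := B c * (r' - p) / 2.
have T0 : 0 < T by rewrite /T divr_gt0// mulr_gt0// subr_gt0.
pose s := p - r.
have s0 : 0 < s by rewrite subr_gt0.
(* For [k >= 1] one has [gau (k * s) <= (k * s ^+ 2)^-1], so [k >= n] is enough to meet the
   smallness condition of [gaussian_mean_positive]. *)
have [n hn] : exists n : nat, 2 * r * M / T / s ^+ 2 < n%:R.
  exists (Num.bound `|2 * r * M / T / s ^+ 2|).
  by apply: le_lt_trans (ler_norm _) _; apply: archi_boundP.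
pose k := Num.max k0 (Num.max 1 n%:R).
have [kk0 k1' kn] : [/\ k0 <= k, 1 <= k & n%:R <= k].
  by split; rewrite /k !le_max lexx ?orbT.
have kp : 0 < k by exact: lt_le_trans kk0.
have kp' : 0 < k^-1 by rewrite invr_gt0.
pose h x := gau (k^-1 * x) * FT_re B x.
have lg : L1 (fun x : R => gau (k^-1 * x)) by apply: L1_dilate => //; exact: L1_gau.
have lh : L1 h.
  apply: (L1M_bounded lg (L1_measurable lFB) (C := Int (fun x => `|B x|))) => x.
  exact: FT_re_bound.
have ch : continuous h.
  move=> x; apply: cvgM; last exact: FT_re_continuous.
  by apply: continuous_dilate; exact: gau_continuous.
have eh x : h (- x) = h x by rewrite /h mulrN gauN FT_reN.
have h00 : h 0 < 0 by rewrite /h mulr0 gau0 mul1r.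
have hr' x : r' <= `|x| -> 0 <= h x.
  by move=> hx; rewrite mulr_ge0 ?FBr'// ltW ?gau_gt0.
have Fh0 : FT_re h 0 < 0.
  rewrite FT_re_gau_mul//.
  have -> : Int (fun t => B t * ((k * gau (k * (t + 0)) + k * gau (k * (t - 0))) / 2)) =
      Int (fun t => B t * (k * gau (k * t))).
    by apply: eq_Int => t; rewrite subr0 addr0; congr (_ * _); lra.
  by have := hk0 k kk0; rewrite ler_norml; lra.
have Fhr' x : r' <= `|x| -> 0 <= FT_re h x.
  move=> hx; rewrite -FT_re_norm.
  apply: (@gaussian_mean_positive B r p r' k (B c) M) => //; rewrite -/s -/T.
  have s2 : 0 < s ^+ 2 by exact: exprn_gt0.
  have e1 : gau (k * s) <= (k * s ^+ 2)^-1.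
    apply: le_trans (gau_le_quadratic _) _; rewrite div1r lef_pV2 ?posrE ?one_sqr_gt0 ?mulr_gt0//.
    rewrite exprMn; apply: (@le_trans _ _ (k ^+ 2 * s ^+ 2)); last by rewrite lerDr.
    by rewrite ler_wpM2r ?(ltW s2)// expr2 ler_peMr// ltW.
  have rM : 0 <= 2 * r * M by rewrite !mulr_ge0// ltW.
  apply: le_trans (ler_wpM2l rM e1) _.
  rewrite ler_pdivrMr ?mulr_gt0//.
  move: (lt_le_trans hn kn) => /ltW; rewrite ler_pdivrMr// ler_pdivrMr//.
  by rewrite [T * _]mulrC.
exists h; split => //.
- split => //.
  + by split => //; apply: L1_FT_re_mul => //; rewrite (funext (fun x => FT_re_gau_dilate x kp));
      apply: L1Z; apply: L1_dilate => //; exact: L1_gau.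
  + by move=> xi; exact: FT_im_even.
  + by split; [exists r'|exact: ltW].
  + by split; [exists r'|exact: ltW].
- by exists 0; rewrite lt_eqF.
- exact: schwartz_gau_mul_FT_re.
Qed.

End GaussianCutoff.

(** * Reduction to self-dual functions and comparison of the infima *)

Section SignConstants.
Context {R : realType}.
Implicit Types (f g : R -> R).

Lemma selfdual_of_inAplus f (r1 r2 : R) : inAplus f -> (exists x, f x != 0) ->
  0 < r1 -> 0 < r2 -> (forall x, r1 <= `|x| -> 0 <= f x) ->
  (forall x, r2 <= `|x| -> 0 <= FT_re f x) ->
  exists F, [/\ selfdual F, (exists x, F x != 0), F 0 <= 0 &
    forall x, Num.sqrt (r1 * r2) <= `|x| -> 0 <= F x].
Proof.
move=> [cf [lf lff] im0 [_ ff0] [_ f0]] [x1 fx1] r10 r20 fr1 fr2.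
have inv := FT_re_inversion cf lf lff im0.
(* The dilation that balances the radii: [r1 / l] and [l * r2] both equal [rho]. *)
pose l := Num.sqrt (r1 / r2).
have l0 : 0 < l by rewrite sqrtr_gt0 divr_gt0.
have l0' : 0 < l^-1 by rewrite invr_gt0.
set rho := Num.sqrt (r1 * r2).
have rho0 : 0 < rho by rewrite sqrtr_gt0 mulr_gt0.
have lr2 : l * r2 = rho.
  rewrite /l /rho -[X in _ * X](gtr0_norm r20) -sqrtr_sqr -sqrtrM ?divr_ge0 ?ltW//.
  by congr Num.sqrt; field; rewrite gt_eqF.
have lrho : l * rho = r1.
  rewrite /l /rho -sqrtrM ?divr_ge0 ?ltW// -[RHS](gtr0_norm r10) -sqrtr_sqr.
  by congr Num.sqrt; field; rewrite gt_eqF.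
pose f1 x := f (l * x).
have lf1 : L1 f1 by exact: L1_dilate.
have E1 x : FT_re f1 x = l^-1 * FT_re f (l^-1 * x) by exact: FT_re_dilate.
have lE1 : L1 (FT_re f1) by rewrite (funext E1); apply: L1Z; exact: L1_dilate.
have E2 : FT_re (FT_re f1) = f1.
  rewrite (funext E1); apply/funext => x; rewrite FT_reZ; last exact: L1_dilate.
  by rewrite FT_re_dilate// inv invrK mulrA mulVf ?mul1r// gt_eqF.
have f1r x : rho <= `|x| -> 0 <= f1 x.
  move=> hx; apply: fr1; rewrite normrM (gtr0_norm l0) -lrho ler_wpM2l// ltW//.
have F1r x : rho <= `|x| -> 0 <= FT_re f1 x.
  move=> hx; rewrite E1 mulr_ge0 ?(ltW l0')//; apply: fr2.
  by rewrite normrM (gtr0_norm l0') mulrC ler_pdivlMr// mulrC lr2.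
exists (fun x => f1 x + FT_re f1 x); split.
- split; [|exact: L1D|].
    move=> x; apply: cvgD; first exact: continuous_dilate.
    exact: FT_re_continuous.
  by rewrite FT_reD// E2; apply/funext => x; rewrite addrC.
- apply: contrapT => h.
  have z x : f1 x + FT_re f1 x = 0 by apply: contrapT => hx; apply: h; exists x; apply/eqP.
  have z1 x : rho <= `|x| -> f1 x = 0.
    by move=> hx; have := z x; have := f1r x hx; have := F1r x hx; lra.
  have z2 x : FT_re f1 x = 0.
    apply: (@compact_support_FT_re R f1 rho rho lf1 z1) => {}x hx.
    have hx' : rho <= `|x| by apply: le_trans hx (ler_norm x).
    by have := z x; rewrite z1// add0r.
  move/eqP: fx1; apply; have := z (l^-1 * x1); rewrite z2 addr0 /f1.
  by rewrite mulrA divff ?mul1r// gt_eqF.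
- by rewrite /f1 E1 !mulr0; have := mulr_ge0_le0 (ltW l0') ff0; lra.
- by move=> x hx; rewrite addr_ge0 ?f1r ?F1r.
Qed.

(** The common source of both kinds of competitor. The gap between [sqrt (r1 * r2)] and [rho] is
    spent in two halves: up to [r] for strictness, from [r] to [rho] for the cutoff. *)
Lemma inAplus_cutoff f (r1 r2 rho : R) : inAplus f -> (exists x, f x != 0) ->
  0 < r1 -> 0 < r2 -> (forall x, r1 <= `|x| -> 0 <= f x) ->
  (forall x, r2 <= `|x| -> 0 <= FT_re f x) -> Num.sqrt (r1 * r2) < rho ->
  exists B r, [/\ [/\ continuous B, L1_csupp B, forall x, B (- x) = B x & L1 (FT_re B)],
    0 < r < rho, B 0 < 0 /\ FT_re B 0 < 0,
    (forall x, r <= `|x| -> 0 <= B x) /\ (forall x, r < x <= rho -> 0 < B x) &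
    (forall x, rho <= `|x| -> 0 <= FT_re B x)].
Proof.
move=> Af fn0 r10 r20 fr1 fr2 hrho.
have [F [sF Fn0 F0 Fr]] := selfdual_of_inAplus Af fn0 r10 r20 fr1 fr2.
set s := Num.sqrt _ in hrho Fr.
have s0 : 0 < s by rewrite sqrtr_gt0 mulr_gt0.
pose r := (s + rho) / 2.
have sr : s < r by rewrite /r; lra.
have r0 : 0 < r by lra.
have rrho : r < rho by rewrite /r; lra.
have [G [c [sG G0 c0 Gc]]] := selfdual_strict sF Fn0 s0 sr F0 Fr.
have [k [hk FB0 FBr]] := selfdual_triangle_cutoff sG G0 c0 r0 rrho Gc.
have [cG lG GG] := sG.
have k0 : 0 < k by lra.
have k0' : 0 < k^-1 by rewrite invr_gt0.
have Gpos x : r <= `|x| -> 0 < G x.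
  by move=> hx; apply: lt_le_trans (Gc x hx); rewrite divr_gt0 ?one_sqr_gt0.
have lB : L1 (fun x => triangle (k^-1 * x) * G x).
  under eq_fun do rewrite mulrC.
  have lt : L1 (fun x : R => triangle (k^-1 * x)) by apply: L1_dilate => //; exact: L1_triangle.
  apply: (L1M_bounded lG (L1_measurable lt) (C := 1)) => x.
  by rewrite ger0_norm ?triangle_ge0// triangle_le1.
exists (fun x => triangle (k^-1 * x) * G x), r; split.
- split.
  + move=> x; apply: cvgM; last exact: cG.
    by apply: continuous_dilate; exact: triangle_continuous.
  + split => //; exists k => t kt; rewrite triangle_supp ?mul0r//.
    by rewrite normrM (gtr0_norm k0') mulrC ler_pdivlMr// mul1r.
  + by move=> x; rewrite mulrN triangleN (selfdual_even sG).
  + exact: L1_FT_re_triangle_mul.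
- by rewrite r0 rrho.
- by split => //; rewrite mulr0 triangle0 mul1r.
- split=> [x hx|x /andP[rx xrho]].
    by rewrite mulr_ge0 ?triangle_ge0// ltW// Gpos.
  have x0 : 0 < x by lra.
  apply: mulr_gt0; last by apply: Gpos; rewrite gtr0_norm// ltW.
  have hx : k^-1 * x < 1 by rewrite mulrC ltr_pdivrMr//; lra.
  have hx0 : 0 < k^-1 * x by rewrite mulr_gt0.
  by rewrite triangle_in gtr0_norm//; lra.
- exact: FBr.
Qed.

Lemma inAplus_bandlimited_approx f (r1 r2 rho : R) : inAplus f -> (exists x, f x != 0) ->
  0 < r1 -> 0 < r2 -> (forall x, r1 <= `|x| -> 0 <= f x) ->
  (forall x, r2 <= `|x| -> 0 <= FT_re f x) -> Num.sqrt (r1 * r2) < rho ->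
  exists g, [/\ inAplus g, (exists x, g x != 0), bandlimited g,
    (forall x, rho <= `|x| -> 0 <= g x) & (forall x, rho <= `|x| -> 0 <= FT_re g x)].
Proof.
move=> Af fn0 r10 r20 fr1 fr2 hrho.
have [B [r [[cB [lB [k Bk]] eB lFB] /andP[r0 rr] [B0 FB0] [Br _] FBr]]] :=
  inAplus_cutoff Af fn0 r10 r20 fr1 fr2 hrho.
have Brho x : rho <= `|x| -> 0 <= B x.
  by move=> hx; apply: Br; exact: le_trans (ltW rr) hx.
have [inv Ag] := inAplus_FT_re cB lB eB lFB (ltW B0) (ltW FB0) Brho FBr.
exists (FT_re B); split => //.
- by exists 0; rewrite lt_eqF.
- by exists k => xi hxi; rewrite inv Bk//; split=> //; case: Ag.
- by rewrite inv.
Qed.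

Lemma inAplus_schwartz_approx f (r1 r2 rho : R) : inAplus f -> (exists x, f x != 0) ->
  0 < r1 -> 0 < r2 -> (forall x, r1 <= `|x| -> 0 <= f x) ->
  (forall x, r2 <= `|x| -> 0 <= FT_re f x) -> Num.sqrt (r1 * r2) < rho ->
  exists g, [/\ inAplus g, (exists x, g x != 0), schwartz g,
    (forall x, rho <= `|x| -> 0 <= g x) & (forall x, rho <= `|x| -> 0 <= FT_re g x)].
Proof.
move=> Af fn0 r10 r20 fr1 fr2 hrho.
have [B [r [[cB sB eB lFB] /andP[r0 rr] [B0 FB0] [Br Bpos] FBr]]] :=
  inAplus_cutoff Af fn0 r10 r20 fr1 fr2 hrho.
exact: (schwartz_of_bandlimited cB sB eB lFB r0 rr B0 FB0 Br Bpos FBr).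
Qed.

Definition nonneg_radii f := [set r : R | 0 < r /\ forall x : R, r <= `|x| -> 0 <= f x].

Lemma nonneg_radii_lbound f : lbound (nonneg_radii f) 0.
Proof. by move=> r [/ltW]. Qed.

Lemma rsign_le f (r : R) : nonneg_radii f r -> rsign f <= r.
Proof. by move=> h; apply: ge_inf => //; exists 0; exact: nonneg_radii_lbound. Qed.

Lemma nonneg_radii_nonempty f : eventually_nonneg f -> nonneg_radii f !=set0.
Proof.
move=> [r fr]; exists (Num.max 1 r); split; first by rewrite lt_max ltr01.
by move=> x; rewrite ge_max => /andP[_]; exact: fr.
Qed.

Lemma rsign_ge f (y : R) : eventually_nonneg f -> (forall r, nonneg_radii f r -> y <= r) ->
  y <= rsign f.
Proof. by move=> /nonneg_radii_nonempty h1 h2; exact: lb_le_inf. Qed.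

Lemma rsign_ge0 f : eventually_nonneg f -> 0 <= rsign f.
Proof. by move=> h; apply: rsign_ge => // r [/ltW]. Qed.

(** [rsign] is an infimum, so the approximation is assumed for actual radii [r1], [r2]. The
    resulting bound [inf S2 ^+ 2 <= r1 * r2] is passed to the infimum in one radius at a time. *)
Lemma Aplus_const_approx (P : (R -> R) -> Prop) :
  (forall f (r1 r2 rho : R), inAplus f -> (exists x, f x != 0) ->
    nonneg_radii f r1 -> nonneg_radii (FT_re f) r2 -> Num.sqrt (r1 * r2) < rho ->
    exists g, [/\ inAplus g, (exists x, g x != 0), P g,
      (forall x, rho <= `|x| -> 0 <= g x) & (forall x, rho <= `|x| -> 0 <= FT_re g x)]) ->
  Aplus_const (fun=> True) = Aplus_const P.
Proof.
move=> HP; rewrite /Aplus_const.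
set S1 := [set _ | _ in _]; set S2 := [set _ | _ in _].
have lb (Q : (R -> R) -> Prop) : lbound [set Num.sqrt (rsign f * rsign (FT_re f)) |
       f in [set f : R -> R | inAplus f /\ (exists x, f x != 0) /\ Q f]] 0.
  by move=> _ [f _ <-]; exact: sqrtr_ge0.
have S21 : S2 `<=` S1.
  by move=> _ [f [Af [fn0 _]] <-]; exists f.
(* If there is no competitor at all, both sides are the same default value of [inf] on the empty
   set. *)
have [S10|/set0P[y0 S1y0]] := eqVneq S1 set0.
  have -> : S2 = set0 by apply/seteqP; split => // x /S21; rewrite S10.
  by rewrite S10.
have key f (r1 r2 : R) : inAplus f -> (exists x, f x != 0) ->
    nonneg_radii f r1 -> nonneg_radii (FT_re f) r2 ->
    S2 !=set0 /\ inf S2 <= Num.sqrt (r1 * r2).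
  move=> Af fn0 h1 h2.
  have H (rho : R) : Num.sqrt (r1 * r2) < rho -> S2 !=set0 /\ inf S2 <= rho.
    move=> hrho; have [g [Ag gn0 Pg gr Fgr]] := HP f r1 r2 rho Af fn0 h1 h2 hrho.
    have rho0 : 0 < rho by apply: le_lt_trans hrho; exact: sqrtr_ge0.
    have m : S2 (Num.sqrt (rsign g * rsign (FT_re g))) by exists g.
    split; first by exists (Num.sqrt (rsign g * rsign (FT_re g))).
    apply: (@le_trans _ _ (Num.sqrt (rsign g * rsign (FT_re g)))).
      by apply: ge_inf => //; exists 0; exact: lb.
    have [_ _ _ [eg _] [eFg _]] := Ag.
    rewrite -[leRHS](gtr0_norm rho0) -sqrtr_sqr ler_wsqrtr// expr2.
    by apply: ler_pM; [exact: rsign_ge0|exact: rsign_ge0|exact: rsign_le|exact: rsign_le].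
  split; first by have [|] := H (Num.sqrt (r1 * r2) + 1); rewrite ?ltrDl.
  apply/ler_addgt0Pr => e e0.
  by have [] := H (Num.sqrt (r1 * r2) + e); rewrite ?ltrDl.
have S2n : S2 !=set0.
  case: S1y0 => f [Af [fn0 _]] _.
  have [_ _ _ [/nonneg_radii_nonempty[r1 h1] _] [/nonneg_radii_nonempty[r2 h2] _]] := Af.
  by have [] := key f r1 r2 Af fn0 h1 h2.
apply/eqP; rewrite eq_le; apply/andP; split.
  apply: lb_le_inf => // y /S21 S1y; apply: ge_inf => //; exists 0; exact: lb.
apply: lb_le_inf; first by exists y0.
move=> _ [f [Af [fn0 _]] <-].
have [_ _ _ [ef _] [eFf _]] := Af.
have i0 : 0 <= inf S2 by apply: lb_le_inf => //; exact: lb.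
have sq r1 r2 : nonneg_radii f r1 -> nonneg_radii (FT_re f) r2 -> inf S2 ^+ 2 <= r1 * r2.
  move=> h1 h2; have [_ h] := key f r1 r2 Af fn0 h1 h2.
  have r12 : 0 <= r1 * r2 by rewrite mulr_ge0// ltW//; [case: h1|case: h2].
  by rewrite -(sqr_sqrtr r12) ler_sqr ?nnegrE ?sqrtr_ge0.
rewrite -[leLHS](ger0_norm i0) -sqrtr_sqr ler_wsqrtr//.
have h1 r1 : nonneg_radii f r1 -> inf S2 ^+ 2 <= r1 * rsign (FT_re f).
  move=> hr1; have r10 : 0 < r1 by case: hr1.
  rewrite mulrC -ler_pdivrMr//; apply: rsign_ge => // r2 hr2.
  by rewrite ler_pdivrMr// mulrC; exact: sq.
(* If this [rsign] is 0 one cannot divide by it, but then any single radius [r1] already gives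
   [inf S2 ^+ 2 <= 0]. *)
have := rsign_ge0 eFf; rewrite le_eqVlt => /predU1P[e0|e0].
  have [r1 hr1] := nonneg_radii_nonempty ef.
  by have := h1 r1 hr1; rewrite -e0 !mulr0.
rewrite -ler_pdivrMr//; apply: rsign_ge => // r1 hr1.
by rewrite ler_pdivrMr//; exact: h1.
Qed.

End SignConstants.

(* A_+(1) = A_+^B(1) = A_+^S(1) *)
Theorem theorem1 (R : realType) :
  @Aplus_const R (fun _ => True) = @Aplus_const R bandlimited /\
  @Aplus_const R bandlimited = @Aplus_const R schwartz.
Proof.
have hB : @Aplus_const R (fun=> True) = @Aplus_const R bandlimited.
  apply: Aplus_const_approx => f r1 r2 rho Af fn0 [r10 h1] [r20 h2].
  exact: (inAplus_bandlimited_approx Af fn0 r10 r20 h1 h2).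
have hS : @Aplus_const R (fun=> True) = @Aplus_const R schwartz.
  apply: Aplus_const_approx => f r1 r2 rho Af fn0 [r10 h1] [r20 h2].
  exact: (inAplus_schwartz_approx Af fn0 r10 r20 h1 h2).
by split; [exact: hB|rewrite -hB].
Qed.
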